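(* Let $k\ge 1$ be an integer. There exist constants $C=C_k>0$ and $\alpha=\alpha_k>0$, depending only on $k$, such that the following holds. Let $\mu$ be a non-atomic probability measure on a measurable space $(X,\mathcal X)$, let $n\ge 1$, let $\xi_1,\dots,\xi_n$ be independent $X$-valued random variables with distribution $\mu$, and let $f=f(x_1,\dots,x_k)$ be a measurable function on $(X^k,\mathcal X^k,\mu^k)$ such that $$\|f\|_\infty=\sup_{x_j\in X,\;1\le j\le k}|f(x_1,\dots,x_k)|\le 1$$ and $$\|f\|_2^2=\int f^2(x_1,\dots,x_k)\,\mu(dx_1)\dots\mu(dx_k)\le\sigma^2$$ with some constant $\sigma>0$. Then $$P\left(|J_{n,k}(f)|>x\right)\le C\exp\left\{-\alpha\left(\frac x\sigma\right)^{2/k}\right\}\quad\text{for all } 0<x\le n^{k/2}\sigma^{k+1}.$$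
   Context: Let $\xi_1,\dots,\xi_n$ be i.i.d. random variables with values in $(X,\mathcal X)$ and distribution $\mu$. The empirical measure is $\mu_n(A)=\frac1n\#\{j:\ \xi_j\in A,\ 1\le j\le n\}$, $A\in\mathcal X$. For a function $f$ of $k\ge1$ variables, $$J_{n,k}(f)=\frac{n^{k/2}}{k!}\int' f(u_1,\dots,u_k)\,(\mu_n(du_1)-\mu(du_1))\dots(\mu_n(du_k)-\mu(du_k)),$$ where the prime means that the diagonals $u_j=u_l$, $1\le j<l\le k$, are omitted from the domain of integration. *)

(* Defs.v *)
From HB Require Import structures.
From mathcomp Require Import all_boot all_order all_algebra.
From mathcomp Require Import all_classical all_reals all_analysis.
From mathcomp Require Import measurable_realfun.

Set Implicit Arguments.
Unset Strict Implicit.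
Unset Printing Implicit Defensive.
Import Order.TTheory GRing.Theory Num.Theory.
Import numFieldNormedType.Exports.

Local Open Scope classical_set_scope.
Local Open Scope ring_scope.

Section NonAtomic.
Local Open Scope ereal_scope.
Context d (X : measurableType d) (R : realType).
Variable mu : {measure set X -> \bar R}.

Definition is_atom (A : set X) : Prop :=
  [/\ measurable A, 0 < mu A &
      forall B, measurable B -> B `<=` A -> mu B = 0 \/ mu B = mu A].

Definition non_atomic : Prop := forall A, ~ is_atom A.

End NonAtomic.

Section RandomVariables.
Local Open Scope ereal_scope.
Context dO dX (Omega : measurableType dO) (X : measurableType dX)
  (R : realType).
Variable P : probability Omega R.

Definition mutually_independent n (xi : 'I_n -> {RV P >-> X}) : Prop :=
  forall (J : {set 'I_n}) (A : 'I_n -> set X),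
    (forall j, measurable (A j)) ->
    P (\bigcap_(j in [set` J]) (xi j @^-1` A j)) =
    \prod_(j in J) P (xi j @^-1` A j).

Definition has_distribution (Y : {RV P >-> X}) (mu : probability X R) : Prop :=
  forall A, measurable A -> distribution P Y A = mu A.

(* Outer probability of E.  It is P E when E is measurable, by
   [measurable_mu_extE], and the value of the completion of P at E when E is
   measurable up to a P-null set.  It is needed because on an arbitrary
   measurable space X the diagonal of X * X need not be measurable, so that a
   random variable defined by an integral omitting the diagonals may be
   measurable only up to a null set; and the library gives P no meaning on
   non-measurable sets. *)
Definition outer_prob (E : set Omega) : \bar R := mu_ext P E.

End RandomVariables.

(* The empirical measure is defined on all subsets of X, so that every
   function is measurable for it.  On the given sigma-algebra of X the library
   integral of a function which is not measurable (such as one obtained by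
   removing non-measurable diagonals) would not be its sample mean. *)
Definition discrete_space d (X : measurableType d) :=
  g_sigma_algebraType (@discrete_measurable X).

Section EmpiricalMeasure.
Context d (X : measurableType d) (R : realType).
Variables (n : nat) (x : 'I_n -> X).

Lemma discrete_space_measurable (A : set (discrete_space X)) : measurable A.
Proof. exact: sub_sigma_algebra. Qed.

Definition empirical (A : set (discrete_space X)) : \bar R :=
  (n%:R^-1 * #|[pred j : 'I_n | x j \in A]|%:R)%:E.

Let dir (i : nat) : {measure set (discrete_space X) -> \bar R} :=
  if insub i is Some j then \d_(x j : discrete_space X) else mzero.

Let dirE (j : 'I_n) : dir j = \d_(x j : discrete_space X).
Proof. by rewrite /dir valK. Qed.

Let ninv : {nonneg R} := (n%:R^-1)%:nng.

Let empiricalE : empirical = mscale ninv (msum dir n).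
Proof.
apply/funext => A; rewrite /empirical /mscale EFinM/= /msum; congr (_ * _)%E.
rewrite (eq_bigr (fun j => \d_(x j : discrete_space X) A)); last first.
  by move=> j _; rewrite dirE.
rewrite -sum1_card natr_sum big_mkcond/= -sumEFin; apply: eq_bigr => j _.
by rewrite diracE inE; case: (x j \in A).
Qed.

Let empirical0 : empirical set0 = 0%E.
Proof. by rewrite empiricalE measure0. Qed.

Let empirical_ge0 A : (0 <= empirical A)%E.
Proof. by rewrite empiricalE measure_ge0. Qed.

Let empirical_sigma_additive : semi_sigma_additive empirical.
Proof. by rewrite empiricalE; exact: measure_semi_sigma_additive. Qed.

HB.instance Definition _ := isMeasure.Build _ _ _ empirical
  empirical0 empirical_ge0 empirical_sigma_additive.

Lemma integral_empirical (g : X -> R) :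
  let mu_n : {measure set (discrete_space X) -> \bar R} := empirical in
  \int[mu_n]_u g u = n%:R^-1 * \sum_(j < n) g (x j).
Proof.
move=> mu_n.
have mg (h : X -> \bar R) : @measurable_fun _ _ (discrete_space X) _ setT h.
  by move=> _ B _; exact: discrete_space_measurable.
have pos (h : X -> R) : (forall u, 0 <= h u) ->
    (\int[mu_n]_u (h u)%:E = (n%:R^-1 * \sum_(j < n) h (x j))%:E)%E.
  move=> h0.
  rewrite (eq_measure_integral (mscale ninv (msum dir n))); last first.
    by move=> A _ _; rewrite -[mu_n A]/(empirical A) empiricalE.
  rewrite ge0_integral_mscale//; last by move=> u _; rewrite lee_fin.
  rewrite ge0_integral_measure_sum//; last by move=> u _; rewrite lee_fin.
  rewrite EFinM -sumEFin; congr (_ * _)%E; apply: eq_bigr => j _.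
  by rewrite dirE integral_dirac// diracT mul1e.
rewrite /Rintegral integralE.
rewrite [X in fine (X - _)%E](_ : _ = \int[mu_n]_u (g^\+ u)%:E)%E; last first.
  by apply: eq_integral => u _; rewrite funeposE /funrpos EFin_max.
rewrite [X in fine (_ - X)%E](_ : _ = \int[mu_n]_u (g^\- u)%:E)%E; last first.
  by apply: eq_integral => u _; rewrite funenegE /funrneg EFin_max.
rewrite !pos// -EFinB /= -mulrBr -sumrB; congr (_ * _).
by apply: eq_bigr => j _; rewrite -[in RHS](funrposBneg g).
Qed.

End EmpiricalMeasure.
Arguments empirical {d X} R {n} x A.

Section MultipleIntegrals.
Context d (X : measurableType d) (R : realType).

(* Iterated integral int ... int f(u_1, ..., u_k) I(du_k) ... I(du_1), where
   [I g] stands for the integral of g with respect to a (signed) measure. *)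
Fixpoint iterated_integral (I : (X -> R) -> R) (k : nat) :
    (k.-tuple X -> R) -> R :=
  match k with
  | 0 => fun f => f [tuple]
  | k'.+1 => fun f =>
      I (fun u => iterated_integral I (fun t => f [tuple of u :: t]))
  end.

Variable mu : probability X R.

(* The integral of g with respect to the signed measure mu_n - mu, where mu_n is
   the empirical measure of the sample x_1, ..., x_n. *)
Definition integral_empirical_minus n (x : 'I_n -> X) (g : X -> R) : R :=
  let mu_n : {measure set (discrete_space X) -> \bar R} := empirical R x in
  \int[mu_n]_u g u - \int[mu]_u g u.

Definition off_diagonal k : set (k.-tuple X) :=
  [set u | forall j l : 'I_k, (j < l)%N -> tnth u j <> tnth u l].

(* J_{n,k}(f) for the sample x_1, ..., x_n. *)
Definition J n k (x : 'I_n -> X) (f : k.-tuple X -> R) : R :=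
  n%:R `^ (k%:R / 2) / k`!%:R *
  iterated_integral (integral_empirical_minus x) (f \_ (@off_diagonal k)).

Definition sup_norm k (f : k.-tuple X -> R) : \bar R :=
  ereal_sup (range (fun u => `|f u|%:E)).

Definition L2_norm_sq k (f : k.-tuple X -> R) : R :=
  iterated_integral (fun g => \int[mu]_u g u) (fun u => f u ^+ 2).

End MultipleIntegrals.

(* Main.v *)
Require Import Defs.
From HB Require Import structures.
From mathcomp Require Import all_boot all_order all_algebra.
From mathcomp Require Import all_classical all_reals all_analysis.
From mathcomp Require Import measurable_realfun.
From mathcomp Require Import ring lra zify.
Import Order.TTheory GRing.Theory Num.Theory.
Import numFieldNormedType.Exports.

(* The proof estimates the moments of J directly. For a sample x without ties,
   J is n^(k/2) / k! times n^(-k) times the sum, over all maps c from the k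
   variables to the n sample indices, of the integral of f against the product
   of the signed measures delta_(x_(c i)) - mu, diagonals omitted. In the
   expectation of a 2M-fold product of such terms a sample point which is used
   exactly once integrates to 0, so only the index systems in which every used
   value is taken at least twice contribute. If B values are used, deleting at
   most 2 (k M - B) of the 2M factors leaves a product in which every sample
   point occurs in at most two factors, and Finner's inequality bounds its
   expectation by the product of the L2 norms. There are at most
   'C(n, B) * B ^ (2 k M) such systems, and for L = k M <= n sigma^2 the sum over
   B <= L gives E J^(2M) <= (8 e L)^L sigma^(2M). Markov's inequality with M of
   order (x / sigma)^(2/k) / k yields the theorem. Ties have outer probability 0,
   since a non-atomic measure admits a countable partition of X into sets of
   arbitrarily small measure. *)

Set Implicit Arguments.
Unset Strict Implicit.
Unset Printing Implicit Defensive.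

Local Open Scope classical_set_scope.
Local Open Scope ring_scope.

Section BoundedMeasurable.
Context {R : realType}.

Definition bmeas d (T : measurableType d) (g : T -> R) :=
  measurable_fun [set: T] g /\ exists M, forall x, `|g x| <= M.

Section Closure.
Context d (T : measurableType d).
Implicit Types f g : T -> R.

Lemma bmeas_cst (c : R) : bmeas (fun _ : T => c).
Proof. by split; [exact: measurable_cst|exists `|c|]. Qed.

Lemma bmeasD f g : bmeas f -> bmeas g -> bmeas (fun x => f x + g x).
Proof.
move=> [mf [A fA]] [mg [B gB]]; split; first exact: measurable_funD.
by exists (A + B) => x; rewrite (le_trans (ler_normD _ _))// lerD.
Qed.

Lemma bmeasM f g : bmeas f -> bmeas g -> bmeas (fun x => f x * g x).
Proof.
move=> [mf [A fA]] [mg [B gB]]; split; first exact: measurable_funM.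
by exists (A * B) => x; rewrite normrM ler_pM.
Qed.

Lemma bmeasZ (c : R) f : bmeas f -> bmeas (fun x => c * f x).
Proof. exact: bmeasM (bmeas_cst c). Qed.

Lemma bmeas_sum (I : Type) (s : seq I) (P : pred I) (F : I -> T -> R) :
  (forall i, bmeas (F i)) -> bmeas (fun x => \sum_(i <- s | P i) F i x).
Proof.
move=> bF; elim: s => [|i s IH].
  by under eq_fun do rewrite big_nil; exact: bmeas_cst.
under eq_fun do rewrite big_cons.
by case: (P i) => //; exact: bmeasD.
Qed.

Lemma bmeas_prod (I : Type) (s : seq I) (P : pred I) (F : I -> T -> R) :
  (forall i, bmeas (F i)) -> bmeas (fun x => \prod_(i <- s | P i) F i x).
Proof.
move=> bF; elim: s => [|i s IH].
  by under eq_fun do rewrite big_nil; exact: bmeas_cst.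
under eq_fun do rewrite big_cons.
by case: (P i) => //; exact: bmeasM.
Qed.

Lemma bmeasX f n : bmeas f -> bmeas (fun x => f x ^+ n).
Proof.
move=> bf; elim: n => [|n IH].
  by under eq_fun do rewrite expr0; exact: bmeas_cst.
by under eq_fun do rewrite exprS; exact: bmeasM.
Qed.

Lemma bmeas_norm f : bmeas f -> bmeas (fun x => `|f x|).
Proof.
move=> [mf [A fA]]; split; first exact: measurableT_comp.
by exists A => x; rewrite normr_id.
Qed.

End Closure.

Lemma bmeas_comp d1 d2 (T1 : measurableType d1) (T2 : measurableType d2)
    (g : T2 -> R) (h : T1 -> T2) :
  bmeas g -> measurable_fun [set: T1] h -> bmeas (fun x => g (h x)).
Proof.
move=> [mg [A gA]] mh; split; first exact: (measurableT_comp mg mh).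
by exists A.
Qed.

Section Integral.
Context d (T : measurableType d) (mu : probability T R).
Implicit Types f g : T -> R.

Lemma bmeas_integrable g : bmeas g -> mu.-integrable setT (EFin \o g).
Proof.
move=> [mg [M gM]]; apply: measurable_bounded_integrable => //.
  by rewrite (le_lt_trans (probability_le1 _ _))// ltry.
exists M; split; first exact: num_real.
by move=> y My x _; exact: le_trans (gM x) (ltW My).
Qed.

Lemma bmeas_EFin_int g : bmeas g ->
  (\int[mu]_x g x)%:E = (\int[mu]_x (g x)%:E)%E.
Proof.
move=> /bmeas_integrable ig; rewrite /Rintegral fineK//.
exact: integrable_fin_num.
Qed.

Lemma int_cst (c : R) : \int[mu]_x c = c.
Proof.
by rewrite Rintegral_cst// [X in fine X](probability_setT mu) mulr1.
Qed.

Lemma intD f g : bmeas f -> bmeas g ->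
  \int[mu]_x (f x + g x) = \int[mu]_x f x + \int[mu]_x g x.
Proof. by move=> /bmeas_integrable ? /bmeas_integrable ?; rewrite RintegralD. Qed.

Lemma intZ (c : R) f : bmeas f -> \int[mu]_x (c * f x) = c * \int[mu]_x f x.
Proof. by move=> /bmeas_integrable ?; rewrite RintegralZl. Qed.

Lemma int_sum (I : Type) (s : seq I) (P : pred I) (F : I -> T -> R) :
  (forall i, bmeas (F i)) ->
  \int[mu]_x (\sum_(i <- s | P i) F i x) = \sum_(i <- s | P i) \int[mu]_x F i x.
Proof.
move=> bF; elim: s => [|i s IH].
  rewrite big_nil -[RHS]int_cst; apply: eq_Rintegral => x _.
  by rewrite big_nil.
rewrite big_cons -IH; case: ifPn => Pi; last first.
  by apply: eq_Rintegral => x _; rewrite big_cons (negbTE Pi).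
rewrite -intD//; last exact: bmeas_sum.
by apply: eq_Rintegral => x _; rewrite big_cons Pi.
Qed.

Lemma int_le f g : bmeas f -> bmeas g -> (forall x, f x <= g x) ->
  \int[mu]_x f x <= \int[mu]_x g x.
Proof.
by move=> /bmeas_integrable ? /bmeas_integrable ? fg; apply: le_Rintegral.
Qed.

Lemma int_ge0 g : (forall x, 0 <= g x) -> 0 <= \int[mu]_x g x.
Proof. by move=> g0; apply: Rintegral_ge0. Qed.

Lemma int_norm g : bmeas g -> `|\int[mu]_x g x| <= \int[mu]_x `|g x|.
Proof. by move=> /bmeas_integrable ?; apply: le_normr_Rintegral. Qed.

(* AM-GM under the integral: [2 p <= s a + b / s] for every [s > 0]. *)
Lemma int_cauchy_schwarz (p a b : T -> R) : bmeas p -> bmeas a -> bmeas b ->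
  (forall x, 0 <= p x) -> (forall x, 0 <= a x) -> (forall x, 0 <= b x) ->
  (forall x, p x ^+ 2 <= a x * b x) ->
  (\int[mu]_x p x) ^+ 2 <= (\int[mu]_x a x) * (\int[mu]_x b x).
Proof.
move=> bp ba bb p0 a0 b0 pab.
set u := \int[mu]_x p x; set A := \int[mu]_x a x; set B := \int[mu]_x b x.
have u0 : 0 <= u by exact: int_ge0.
have A0 : 0 <= A by exact: int_ge0.
have B0 : 0 <= B by exact: int_ge0.
have key s : 0 < s -> 2 * u <= s * A + s^-1 * B.
  move=> s0; rewrite /u /A /B -!intZ// -intD//;
    [|exact: bmeasZ|exact: bmeasZ].
  apply: int_le.
  - exact: bmeasZ.
  - by apply: bmeasD; exact: bmeasZ.
  - move=> x; rewrite -(ler_pXn2r (n := 2))// ?nnegrE; last 2 first.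
    + by rewrite mulr_ge0.
    + by rewrite addr_ge0// mulr_ge0// ?invr_ge0 ltW.
    have sx : s * s^-1 = 1 by rewrite divff// gt_eqF.
    have := pab x; have := sqr_ge0 (s * a x - s^-1 * b x).
    move: (a x) (b x) (p x) => a' b' p' h1 h2.
    have e : s * a' * (s^-1 * b') = a' * b'.
      by rewrite mulrACA sx mul1r.
    move: (s * a') (s^-1 * b') (a' * b') e h1 h2 => u1 v1 w1 <-.
    by nra.
have [A00|Agt0] := leP A 0.
  have -> : A = 0 by apply/eqP; rewrite eq_le A00 A0.
  rewrite mul0r; have [->|un0] := eqVneq u 0; first by rewrite expr0n.
  have ugt0 : 0 < u by rewrite lt_neqAle eq_sym un0.
  have A00' : A = 0 by apply/eqP; rewrite eq_le A00 A0.
  have := key ((B + 1) / u); rewrite divr_gt0 ?ltr_wpDl// => /(_ isT).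
  rewrite A00' mulr0 add0r invf_div => h.
  have : u / (B + 1) * B < u.
    by rewrite mulrAC ltr_pdivrMr ?ltr_wpDl// ltr_pM2l// ltrDl.
  lra.
have [u00|ugt0] := leP u 0.
  by have -> : u = 0; [apply/eqP; rewrite eq_le u00 u0|rewrite expr0n/= mulr_ge0].
have := key (u / A); rewrite divr_gt0// => /(_ isT).
rewrite divfK ?gt_eqF// invf_div => h.
have {}h : u <= A / u * B by lra.
by move: h; rewrite mulrAC ler_pdivlMr// expr2.
Qed.

Lemma int_sqr_le g : bmeas g -> (\int[mu]_x g x) ^+ 2 <= \int[mu]_x g x ^+ 2.
Proof.
move=> bg; apply: (@le_trans _ _ ((\int[mu]_x `|g x|) ^+ 2)).
  rewrite -[leLHS]real_normK ?num_real// ler_pXn2r ?nnegrE ?int_norm//.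
  exact: int_ge0.
have := @int_cauchy_schwarz (fun x => `|g x|) (fun x => g x ^+ 2) (fun=> 1).
rewrite int_cst mulr1; apply => //.
- exact: bmeas_norm.
- exact: bmeasX.
- exact: bmeas_cst.
- by move=> x; rewrite sqr_ge0.
- by move=> x; rewrite mulr1 real_normK ?num_real.
Qed.

End Integral.

Section Fubini.
Context d1 d2 (T1 : measurableType d1) (T2 : measurableType d2).

Lemma bmeas_param_int (mu : probability T2 R) (G : T1 -> T2 -> R) :
  bmeas (fun z : T1 * T2 => G z.1 z.2) -> bmeas (fun t => \int[mu]_x G t x).
Proof.
move=> bG; have [mG [M GM]] := bG.
have bGt t : bmeas (G t).
  by apply: (bmeas_comp (g := fun z : T1 * T2 => G z.1 z.2) bG (h := pair t));
    exact: pair1_measurable.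
split; last first.
  exists M => t; apply: le_trans (int_norm _ (bGt t)) _.
  rewrite -[leRHS](int_cst mu); apply: int_le.
  - exact: bmeas_norm.
  - exact: bmeas_cst.
  - by move=> x; exact: (GM (t, x)).
have -> : (fun t => \int[mu]_x G t x) =
    (fun t => \int[mu]_x (G t x + M) - M).
  by apply/funext => t; rewrite intD ?int_cst ?addrK//; exact: bmeas_cst.
apply: measurable_funB; last exact: measurable_cst.
apply: measurableT_comp; first exact: fine_measurable.
apply: (measurable_fun_fubini_tonelli_F (fun z : T1 * T2 => (G z.1 z.2 + M)%:E)).
  apply/measurable_EFinP; apply: measurable_funD => //.
by move=> z; rewrite lee_fin; have := GM z; rewrite ler_norml => /andP[]; lra.
Qed.

Lemma int_swap (m1 : probability T1 R) (m2 : probability T2 R)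
    (G : T1 -> T2 -> R) :
  bmeas (fun z : T1 * T2 => G z.1 z.2) ->
  \int[m1]_x \int[m2]_y G x y = \int[m2]_y \int[m1]_x G x y.
Proof.
move=> bG.
have b1 x : bmeas (G x).
  by apply: (bmeas_comp (g := fun z : T1 * T2 => G z.1 z.2) bG (h := pair x));
    exact: pair1_measurable.
have b2 y : bmeas (G ^~ y).
  apply: (bmeas_comp (g := fun z : T1 * T2 => G z.1 z.2) bG
    (h := fun x => (x, y))); exact: pair2_measurable.
rewrite /Rintegral.
under eq_integral do rewrite (bmeas_EFin_int m2 (b1 _)).
under [in RHS]eq_integral do rewrite (bmeas_EFin_int m1 (b2 _)).
by rewrite (Fubini (bmeas_integrable (m1 \x m2)%E bG)).
Qed.

End Fubini.
End BoundedMeasurable.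

Definition upd n (T : Type) (y : 'I_n -> T) (i : 'I_n) (x : T) : 'I_n -> T :=
  fun j => if j == i then x else y j.

Lemma upd_liftS n (T : Type) (y : 'I_n.+1 -> T) (i : 'I_n) x :
  (fun j => upd y (lift ord0 i) x (lift ord0 j)) =
  upd (fun j => y (lift ord0 j)) i x.
Proof.
by apply/funext => j; rewrite /upd (inj_eq (@lift_inj _ ord0)).
Qed.

Section PartialEvaluation.
Context {R : realType} d (X : measurableType d) (mu : probability X R).

(* The variables [i] with [b i] are evaluated at [y i], the others are
   integrated with respect to [mu]. *)
Fixpoint peval k : ('I_k -> bool) -> ('I_k -> X) -> (k.-tuple X -> R) -> R :=
  match k with
  | 0 => fun _ _ f => f [tuple]
  | k'.+1 => fun b y f =>
      let rest u := peval (fun i : 'I_k' => b (lift ord0 i))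
        (fun i : 'I_k' => y (lift ord0 i)) (fun t => f [tuple of u :: t]) in
      if b ord0 then rest (y ord0) else \int[mu]_u rest u
  end.

Definition mean n (F : n.-tuple X -> R) : R :=
  iterated_integral (fun g => \int[mu]_u g u) F.

Lemma mean_peval n (y : 'I_n -> X) (F : n.-tuple X -> R) :
  mean F = peval (fun=> false) y F.
Proof.
rewrite /mean; elim: n y F => //= n IH y F.
by apply: eq_Rintegral => u _; exact: IH.
Qed.

Lemma meanE n (F : n.-tuple X -> R) :
  mean F = peval (fun=> false) (fun=> point) F.
Proof. exact: mean_peval. Qed.

Lemma bmeas_peval d' (T : measurableType d') k (b : 'I_k -> bool)
    (y : T -> 'I_k -> X) (G : T -> k.-tuple X -> R) :
  (forall i, measurable_fun [set: T] (y ^~ i)) ->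
  bmeas (fun z : T * k.-tuple X => G z.1 z.2) ->
  bmeas (fun t => peval b (y t) (G t)).
Proof.
elim: k d' T b y G => [|k IH] d' T b y G my bG /=.
  refine (bmeas_comp (h := fun t : T => (t, [tuple] : 0.-tuple X)) bG _).
  exact: pair2_measurable.
case: (b ord0).
- apply: (IH _ _ _ (fun t i => y t (lift ord0 i))
    (fun t z => G t [tuple of y t ord0 :: z])) => //.
  refine (bmeas_comp (h := fun z : T * k.-tuple X => (z.1, [tuple of y z.1 ord0 :: z.2])) bG _).
  apply: measurable_fun_pair => //=; apply: measurable_cons => //.
  exact: (measurableT_comp (my ord0)).
- apply: (bmeas_param_int mu (G := fun t u => peval _ (fun i => y t (lift ord0 i))
    (fun z => G t [tuple of u :: z]))).
  apply: (IH _ (T * X)%type _ (fun t i => y t.1 (lift ord0 i))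
    (fun t z => G t.1 [tuple of t.2 :: z])).
    by move=> i; exact: (measurableT_comp (my _)).
  refine (bmeas_comp (h := fun z : T * X * k.-tuple X => (z.1.1, [tuple of z.1.2 :: z.2])) bG _).
  apply: measurable_fun_pair => /=; first exact: (measurableT_comp measurable_fst).
  apply: measurable_cons => //; exact: (measurableT_comp measurable_snd).
Qed.

Lemma bmeas_cons k (f : k.+1.-tuple X -> R) : bmeas f ->
  bmeas (fun z : X * k.-tuple X => f [tuple of z.1 :: z.2]).
Proof.
move=> bf; refine (bmeas_comp (h := fun z : X * k.-tuple X =>
  [tuple of z.1 :: z.2]) bf _).
exact: measurable_cons.
Qed.

Lemma bmeas_cons1 k (f : k.+1.-tuple X -> R) u : bmeas f ->
  bmeas (fun t : k.-tuple X => f [tuple of u :: t]).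
Proof.
move=> bf; refine (bmeas_comp (h := fun t : k.-tuple X => [tuple of u :: t]) bf _).
exact: measurable_cons.
Qed.

Lemma bmeas_peval_cons k b y (f : k.+1.-tuple X -> R) : bmeas f ->
  bmeas (fun u => peval b y (fun t : k.-tuple X => f [tuple of u :: t])).
Proof.
move=> bf; apply: (bmeas_peval b (y := fun=> y)
  (G := fun u t => f [tuple of u :: t])).
  by move=> i; exact: measurable_cst.
exact: bmeas_cons.
Qed.

Lemma peval_cst k b y c : peval b y (fun _ : k.-tuple X => c) = c.
Proof.
elim: k b y => //= k IH b y; case: ifP => _; first exact: IH.
by rewrite -[RHS](int_cst mu); apply: eq_Rintegral => u _; exact: IH.
Qed.

Lemma peval_le k b y (f g : k.-tuple X -> R) : bmeas f -> bmeas g ->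
  (forall t, f t <= g t) -> peval b y f <= peval b y g.
Proof.
elim: k b y f g => //= k IH b y f g bf bg fg.
case: ifP => _; first by apply: IH => //; exact: bmeas_cons1.
apply: int_le; [exact: bmeas_peval_cons..|move=> u].
by apply: IH => //; exact: bmeas_cons1.
Qed.

Lemma peval_ge0 k b y (f : k.-tuple X -> R) : (forall t, 0 <= f t) ->
  0 <= peval b y f.
Proof.
elim: k b y f => //= k IH b y f f0; case: ifP => _; first exact: IH.
by apply: int_ge0 => u; exact: IH.
Qed.

Lemma peval_norm k b y (f : k.-tuple X -> R) : bmeas f ->
  `|peval b y f| <= peval b y (fun t => `|f t|).
Proof.
elim: k b y f => //= k IH b y f bf.
case: ifP => _; first by apply: IH; exact: bmeas_cons1.
apply: le_trans (int_norm mu (bmeas_peval_cons _ _ bf)) _.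
apply: int_le => [||u].
- exact: bmeas_norm (bmeas_peval_cons _ _ bf).
- exact: bmeas_peval_cons (bmeas_norm bf).
- by apply: IH; exact: bmeas_cons1.
Qed.

Lemma peval_sqr_le k b y (f : k.-tuple X -> R) : bmeas f ->
  peval b y f ^+ 2 <= peval b y (fun t => f t ^+ 2).
Proof.
elim: k b y f => //= k IH b y f bf.
case: ifP => _; first by apply: IH; exact: bmeas_cons1.
apply: le_trans (int_sqr_le mu (bmeas_peval_cons _ _ bf)) _.
apply: int_le => [||u].
- exact: bmeasX (bmeas_peval_cons _ _ bf).
- exact: bmeas_peval_cons (bmeasX _ bf).
- by apply: IH; exact: bmeas_cons1.
Qed.

Lemma pevalZ k b y c (f : k.-tuple X -> R) : bmeas f ->
  peval b y (fun t => c * f t) = c * peval b y f.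
Proof.
elim: k b y f => //= k IH b y f bf.
case: ifP => _; first by apply: IH; exact: bmeas_cons1.
rewrite -intZ; last exact: bmeas_peval_cons.
by apply: eq_Rintegral => u _; apply: IH; exact: bmeas_cons1.
Qed.

Lemma peval_sum k b y (I : Type) (s : seq I) (P : pred I)
    (F : I -> k.-tuple X -> R) : (forall i, bmeas (F i)) ->
  peval b y (fun t => \sum_(i <- s | P i) F i t) =
  \sum_(i <- s | P i) peval b y (F i).
Proof.
elim: k b y F => //= k IH b y F bF.
case: ifP => _; first by apply: IH => i; exact: bmeas_cons1.
rewrite -int_sum; last by move=> i; exact: bmeas_peval_cons.
by apply: eq_Rintegral => u _; apply: IH => i; exact: bmeas_cons1.
Qed.

Lemma int_peval d' (T : measurableType d') (nu : probability T R)
    k b y (G : T -> k.-tuple X -> R) :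
  bmeas (fun z : T * k.-tuple X => G z.1 z.2) ->
  \int[nu]_s peval b y (G s) = peval b y (fun t => \int[nu]_s G s t).
Proof.
elim: k b y G => //= k IH b y G bG.
have b1 u : bmeas (fun z : T * k.-tuple X => G z.1 [tuple of u :: z.2]).
  refine (bmeas_comp (h := fun z : T * k.-tuple X => (z.1, [tuple of u :: z.2])) bG _).
  by apply: measurable_fun_pair => //; exact: measurable_cons.
case: ifP => _; first exact: IH.
rewrite int_swap.
  by apply: eq_Rintegral => u _; exact: IH.
apply: (bmeas_peval _ (y := fun=> fun i => y (lift ord0 i))
  (G := fun (z : T * X) t => G z.1 [tuple of z.2 :: t])).
  by move=> i; exact: measurable_cst.
refine (bmeas_comp (h := fun z : T * X * k.-tuple X =>
  (z.1.1, [tuple of z.1.2 :: z.2])) bG _).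
apply: measurable_fun_pair; first exact: (measurableT_comp measurable_fst).
apply: measurable_cons => //; exact: (measurableT_comp measurable_snd).
Qed.

Lemma int_peval_upd k b y i (f : k.-tuple X -> R) : bmeas f ->
  \int[mu]_u peval b (upd y i u) f = peval (upd b i false) y f.
Proof.
elim: k b y i f => [? ? []//|k IH] b y i f bf /=.
case: (unliftP ord0 i) => [j ->|->].
- have e : upd b (lift ord0 j) false ord0 = b ord0 by [].
  have e' u : upd y (lift ord0 j) u ord0 = y ord0 by [].
  rewrite e upd_liftS; case: ifP => b0.
    rewrite -IH; last exact: bmeas_cons1.
    by apply: eq_Rintegral => u _; rewrite e' (upd_liftS y j u).
  transitivity (\int[mu]_u \int[mu]_x peval (fun i => b (lift ord0 i))
      (upd (fun i => y (lift ord0 i)) j u) (fun t => f [tuple of x :: t])).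
    by apply: eq_Rintegral => u _; apply: eq_Rintegral => x _; rewrite (upd_liftS y j u).
  rewrite int_swap; last first.
    apply: (bmeas_peval _
      (y := fun (z : X * X) => upd (fun i => y (lift ord0 i)) j z.1)
      (G := fun z t => f [tuple of z.2 :: t])).
      move=> l; rewrite /upd; case: (l == j); last exact: measurable_cst.
      exact: measurable_fst.
    refine (bmeas_comp (h := fun z : X * X * k.-tuple X =>
      [tuple of z.1.2 :: z.2]) bf _).
    by apply: measurable_cons => //; exact: (measurableT_comp measurable_snd).
  by apply: eq_Rintegral => u _; apply: IH; exact: bmeas_cons1.
- rewrite /upd eqxx /=; case: (b ord0); first exact: eq_Rintegral.
  by rewrite int_cst.
Qed.

Definition tupd n (t : n.-tuple X) (i : 'I_n) (u : X) : n.-tuple X :=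
  [tuple upd (tnth t) i u j | j < n].

Lemma tnth_tupd n (t : n.-tuple X) i u : tnth (tupd t i u) = upd (tnth t) i u.
Proof. by apply/funext => j; rewrite tnth_mktuple. Qed.

Lemma tupd_cons0 n (t : n.-tuple X) x u :
  tupd [tuple of x :: t] ord0 u = [tuple of u :: t].
Proof.
apply: eq_from_tnth => j; rewrite tnth_tupd.
by case: (unliftP ord0 j) => [i ->|->]; rewrite /upd ?eqxx ?tnthS.
Qed.

Lemma tupd_consS n (t : n.-tuple X) x i u :
  tupd [tuple of x :: t] (lift ord0 i) u = [tuple of x :: tupd t i u].
Proof.
apply: eq_from_tnth => j; rewrite tnth_tupd.
case: (unliftP ord0 j) => [l ->|->]; last by [].
rewrite tnthS tnth_tupd /upd (inj_eq (@lift_inj _ ord0)) tnthS.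
by case: ifP.
Qed.

Lemma measurable_tupd n i :
  measurable_fun [set: n.-tuple X * X] (fun z => tupd z.1 i z.2).
Proof.
apply/measurable_fun_tnthP => j /=.
have -> : (@tnth n X)^~ j \o (fun z : n.-tuple X * X => tupd z.1 i z.2) =
    (fun z : n.-tuple X * X => if j == i then z.2 else tnth z.1 j).
  by apply/funext => z /=; rewrite tnth_mktuple.
case: (j == i); first exact: measurable_snd.
exact: (measurableT_comp (measurable_tnth j)).
Qed.

Lemma measurable_tupd1 n (t : n.-tuple X) i : measurable_fun [set: X] (tupd t i).
Proof. exact: (measurableT_comp (measurable_tupd i) (pair1_measurable t)). Qed.

Lemma mean_int_tupd n (i : 'I_n) (F : n.-tuple X -> R) : bmeas F ->
  mean F = mean (fun t => \int[mu]_u F (tupd t i u)).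
Proof.
rewrite !meanE.
elim: n i F => [[]//|n IH] i F bF /=.
case: (unliftP ord0 i) => [j ->|->].
- apply: eq_Rintegral => x _; rewrite (IH j); last exact: bmeas_cons1.
  congr peval; apply/funext => t; apply: eq_Rintegral => u _.
  by rewrite tupd_consS.
- rewrite [LHS]int_peval; last exact: bmeas_cons.
  rewrite -[LHS](int_cst mu); apply: eq_Rintegral => x _.
  congr peval; apply/funext => t; apply: eq_Rintegral => u _.
  by rewrite tupd_cons0.
Qed.

End PartialEvaluation.

Section MeanInequalities.
Context {R : realType} d (X : measurableType d) (mu : probability X R).
Local Notation mean := (mean mu).
Local Notation peval := (peval mu).

Lemma peval_ext k (b : 'I_k -> bool) (y y' : 'I_k -> X) (f : k.-tuple X -> R) :
  (forall i, b i -> y i = y' i) -> peval b y f = peval b y' f.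
Proof.
elim: k b y y' f => //= k IH b y y' f yy.
case: ifP => b0; first by rewrite yy//; apply: IH => i; exact: yy.
by apply: eq_Rintegral => u _; apply: IH => i; exact: yy.
Qed.

Lemma mean_cst n c : mean (fun _ : n.-tuple X => c) = c.
Proof. by rewrite meanE peval_cst. Qed.

Lemma mean_le n (F G : n.-tuple X -> R) : bmeas F -> bmeas G ->
  (forall t, F t <= G t) -> mean F <= mean G.
Proof. by move=> bF bG FG; rewrite !meanE; exact: peval_le. Qed.

Lemma mean_ge0 n (F : n.-tuple X -> R) : (forall t, 0 <= F t) -> 0 <= mean F.
Proof. by move=> F0; rewrite meanE; exact: peval_ge0. Qed.

Lemma mean_norm n (F : n.-tuple X -> R) : bmeas F ->
  `|mean F| <= mean (fun t => `|F t|).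
Proof. by move=> bF; rewrite !meanE; exact: peval_norm. Qed.

Lemma meanZ n c (F : n.-tuple X -> R) : bmeas F ->
  mean (fun t => c * F t) = c * mean F.
Proof. by move=> bF; rewrite !meanE; exact: pevalZ. Qed.

Lemma mean_sum n (I : Type) (s : seq I) (P : pred I) (F : I -> n.-tuple X -> R) :
  (forall i, bmeas (F i)) ->
  mean (fun t => \sum_(i <- s | P i) F i t) = \sum_(i <- s | P i) mean (F i).
Proof.
by move=> bF; rewrite meanE peval_sum//; apply: eq_bigr => i _; rewrite meanE.
Qed.

Lemma bmeas_mean_cons n (F : n.+1.-tuple X -> R) : bmeas F ->
  bmeas (fun u => mean (fun t : n.-tuple X => F [tuple of u :: t])).
Proof.
by move=> bF; under eq_fun do rewrite meanE; exact: bmeas_peval_cons.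
Qed.

Lemma int_prod_sqr_le (I : finType) (A D : {set I}) (N : I -> X -> R) (p : X -> R) :
  bmeas p -> (forall l, bmeas (N l)) -> (forall x, 0 <= p x) ->
  (forall l x, 0 <= N l x) -> D \subset A -> (#|D| <= 2)%N ->
  (forall l x, l \in A :\: D -> N l x = N l point) ->
  (forall x, p x ^+ 2 <= \prod_(l in A) N l x) ->
  (\int[mu]_x p x) ^+ 2 <= \prod_(l in A) \int[mu]_x N l x.
Proof.
move=> bp bN p0 N0 DA D2 Ncst pN.
have split (h : I -> R) : \prod_(l in A) h l =
    (\prod_(l <- enum D) h l) * \prod_(l in A :\: D) h l.
  rewrite (big_setID D)/= big_enum/=; congr (_ * _); apply: eq_bigl => l.
  by rewrite (finset.setIidPr DA).
set c := \prod_(l in A :\: D) N l point.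
have c0 : 0 <= c by apply: prodr_ge0.
have intA : \prod_(l in A) \int[mu]_x N l x =
    (\prod_(l <- enum D) \int[mu]_x N l x) * c.
  rewrite split; congr (_ * _); apply: eq_bigr => l lA.
  rewrite -[RHS](int_cst mu); apply: eq_Rintegral => x _; exact: Ncst.
have {}pN x : p x ^+ 2 <= (\prod_(l <- enum D) N l x) * c.
  apply: le_trans (pN x) _; rewrite split le_eqVlt; apply/orP; left.
  by apply/eqP; congr (_ * _); apply: eq_bigr => l lA; exact: Ncst.
rewrite intA; move: pN D2; rewrite cardE.
case: (enum D) => [|l1 [|l2 [|//]]] pN _.
- have := @int_cauchy_schwarz _ _ _ mu p (fun=> 1) (fun=> c) bp
    (bmeas_cst _ _) (bmeas_cst _ _) p0 _ _ _.
  by rewrite !int_cst big_nil; apply => // x; have := pN x; rewrite big_nil.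
- have := @int_cauchy_schwarz _ _ _ mu p (N l1) (fun=> c) bp
    (bN _) (bmeas_cst _ _) p0 _ _ _.
  by rewrite !int_cst big_seq1; apply => // x; have := pN x; rewrite big_seq1.
- rewrite big_cons big_seq1 -mulrA [_ * c]mulrC -intZ//.
  apply: int_cauchy_schwarz => //; first exact: bmeasZ.
    by move=> x; rewrite mulr_ge0.
  by move=> x; have := pN x; rewrite big_cons big_seq1 -mulrA [_ * c]mulrC.
Qed.

(* Finner's inequality with all exponents equal to 2. *)
Lemma mean_prod_sqr_le n (I : finType) (A : {set I}) (g : I -> n.-tuple X -> R)
    (dep : I -> 'I_n -> bool) :
  (forall l, bmeas (g l)) -> (forall l t, 0 <= g l t) ->
  (forall l i t u, ~~ dep l i -> g l (tupd t i u) = g l t) ->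
  (forall i, (#|[set l in A | dep l i]| <= 2)%N) ->
  mean (fun t => \prod_(l in A) g l t) ^+ 2 <=
  \prod_(l in A) mean (fun t => g l t ^+ 2).
Proof.
elim: n g dep => [|n IH] g dep bg g0 gdep dep2.
  by rewrite /mean /= prodrXl.
apply: (@int_prod_sqr_le I A [set l in A | dep l ord0]
  (fun l u => mean (fun t : n.-tuple X => g l [tuple of u :: t] ^+ 2))
  (fun u => mean (fun t : n.-tuple X => \prod_(l in A) g l [tuple of u :: t]))).
- by apply: (bmeas_mean_cons (F := fun t => \prod_(l in A) g l t)); exact: bmeas_prod.
- move=> l; apply: (bmeas_mean_cons (F := fun t => g l t ^+ 2)); exact: bmeasX.
- by move=> x; apply: mean_ge0 => t; apply: prodr_ge0.
- by move=> l x; apply: mean_ge0 => t; rewrite sqr_ge0.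
- by apply/fintype.subsetP => l; rewrite inE => /andP[].
- exact: dep2.
- move=> l x; rewrite !inE => /andP[+ lA]; rewrite lA /= => ldep.
  congr (mean _); apply/funext => t.
  by rewrite -(gdep l ord0 _ point ldep) tupd_cons0.
- move=> x; apply: (IH (fun l t => g l [tuple of x :: t])
    (fun l i => dep l (lift ord0 i))) => //.
  + by move=> l; exact: bmeas_cons1.
  + by move=> l i t u ldep; rewrite -tupd_consS gdep.
Qed.

Lemma bmeas_peval_tnth n k (b : 'I_k -> bool) (c : 'I_k -> 'I_n)
    (f : k.-tuple X -> R) : bmeas f ->
  bmeas (fun t : n.-tuple X => peval b (fun i => tnth t (c i)) f).
Proof.
move=> bf; apply: (bmeas_peval mu b (y := fun t i => tnth t (c i)) (G := fun=> f)).
  by move=> i; exact: measurable_tnth.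
exact: (bmeas_comp bf measurable_snd).
Qed.

Definition inj_on k (A : Type) (b : 'I_k -> bool) (c : 'I_k -> A) :=
  `[< forall i i', b i -> b i' -> c i = c i' -> i = i' >].

Lemma upd_tnth_comp k n (c : 'I_k -> 'I_n) (b : 'I_k -> bool) i (t : n.-tuple X) u
    (f : k.-tuple X -> R) : (forall j, b j -> c j = c i -> j = i) ->
  peval b (fun j => tnth (tupd t (c i) u) (c j)) f =
  peval b (upd (fun j => tnth t (c j)) i u) f.
Proof.
move=> ci; apply: peval_ext => j bj; rewrite tnth_tupd /upd.
have [->|ji] := eqVneq j i; first by rewrite eqxx.
by rewrite ifF//; apply: contraNF ji => /eqP /ci ->.
Qed.

Lemma mean_peval_inj n k (b : 'I_k -> bool) (c : 'I_k -> 'I_n)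
    (f : k.-tuple X -> R) : bmeas f -> inj_on b c ->
  mean (fun t : n.-tuple X => peval b (fun i => tnth t (c i)) f) = mean f.
Proof.
move=> bf; have [m] := ubnP #|[pred i | b i]|.
elim: m b => // m IH b bm /asboolP ci.
have [i bi|b0] := pickP b; last first.
  rewrite -[RHS](@mean_cst n); congr mean; apply/funext => t.
  rewrite meanE -(funext (b0 : b =1 fun=> false)).
  by apply: peval_ext => i; rewrite b0.
rewrite (mean_int_tupd mu (c i)); last exact: bmeas_peval_tnth.
rewrite -(IH (upd b i false)); last 2 first.
- rewrite -ltnS; apply: leq_trans bm; rewrite ltnS; apply: proper_card.
  apply/properP; split; last by exists i; rewrite !inE ?bi// /upd eqxx.
  by apply/fintype.subsetP => j; rewrite !inE /upd; case: ifP.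
- apply/asboolP => j j'; rewrite /upd; case: ifP => // _; case: ifP => // _.
  exact: ci.
congr mean; apply/funext => t; rewrite -int_peval_upd//.
apply: eq_Rintegral => u _; apply: upd_tnth_comp => j bj; exact: ci.
Qed.

Definition sgnb k (b : 'I_k -> bool) : R := \prod_(i < k) (if b i then 1 else -1).

(* The integral of [f] against the product of [delta_(t_(c i)) - mu], diagonals
   omitted. *)
Definition diag_free k n (f : k.-tuple X -> R) (c : 'I_k -> 'I_n) (t : n.-tuple X) : R :=
  \sum_(b : {ffun 'I_k -> bool} | inj_on b c)
    sgnb b * peval b (fun i => tnth t (c i)) f.

Lemma bmeas_diag_free k n (f : k.-tuple X -> R) (c : 'I_k -> 'I_n) : bmeas f ->
  bmeas (diag_free f c).
Proof.
move=> bf; apply: bmeas_sum => b; apply: bmeasZ; exact: bmeas_peval_tnth.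
Qed.

Lemma diag_free_tupd_id k n (f : k.-tuple X -> R) (c : 'I_k -> 'I_n) t a u :
  (forall i, c i != a) -> diag_free f c (tupd t a u) = diag_free f c t.
Proof.
move=> ca; apply: eq_bigr => b _; congr (_ * _); apply: peval_ext => i _.
by rewrite tnth_tupd /upd (negbTE (ca i)).
Qed.

Lemma int_diag_free k n (f : k.-tuple X -> R) (c : 'I_k -> 'I_n) t i :
  bmeas f -> (forall j, c j = c i -> j = i) ->
  \int[mu]_u diag_free f c (tupd t (c i) u) = 0.
Proof.
move=> bf ci; pose y := fun j => tnth t (c j).
pose tog (b : {ffun 'I_k -> bool}) := [ffun j => if j == i then ~~ b j else b j].
have togK : involutive tog.
  by move=> b; apply/ffunP => j; rewrite !ffunE; case: eqP => // _; rewrite negbK.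
have -> : \int[mu]_u diag_free f c (tupd t (c i) u) =
    \sum_(b : {ffun 'I_k -> bool} | inj_on b c)
      sgnb b * peval (upd b i false) y f.
  rewrite /diag_free int_sum; last first.
    move=> b; apply: bmeasZ.
    apply: (bmeas_comp (bmeas_peval_tnth b c bf) (h := tupd t (c i))).
    exact: measurable_tupd1.
  apply: eq_bigr => b _; rewrite -int_peval_upd// -intZ.
    by apply: eq_Rintegral => u _; rewrite upd_tnth_comp// => j _; exact: ci.
  apply: (bmeas_peval mu b (y := fun u => upd y i u) (G := fun=> f)).
    by move=> j; rewrite /upd; case: (j == i); [exact: measurable_id|exact: measurable_cst].
  exact: (bmeas_comp bf measurable_snd).
set S := LHS.
suff : S = - S by lra.
rewrite {1}/S (reindex_inj (inv_inj togK)) /= -sumrN; apply: eq_big => b.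
- apply/asboolP/asboolP => H j j'; have := H j j'; rewrite !ffunE.
    case: eqP => [->|_]; first by case: eqP => [->|_] // _ _ _ /esym /ci ->.
    by case: eqP => [->|_] // _ _ _ /ci ->.
  case: eqP => [->|_]; first by case: eqP => [->|_] // _ _ _ /esym /ci ->.
  by case: eqP => [->|_] // _ _ _ /ci ->.
- move=> _; rewrite -mulNr; congr (_ * _).
    rewrite /sgnb (bigD1 i)//= [in RHS](bigD1 i)//= -mulNr; congr (_ * _).
      by rewrite ffunE eqxx; case: (b i); rewrite ?opprK.
    by apply: eq_bigr => j /negbTE ji; rewrite ffunE ji.
  congr peval; apply/funext => j; rewrite /upd ffunE.
  by case: eqP.
Qed.

Lemma mean_prod_diag_free_eq0 k n (f : k.-tuple X -> R) (I : finType)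
    (c : I -> 'I_k -> 'I_n) l0 i0 :
  bmeas f -> (forall l i, c l i = c l0 i0 -> l = l0 /\ i = i0) ->
  mean (fun t => \prod_l diag_free f (c l) t) = 0.
Proof.
move=> bf cl; rewrite (mean_int_tupd mu (c l0 i0)); last first.
  by apply: bmeas_prod => l; exact: bmeas_diag_free.
rewrite -[RHS](@mean_cst n); congr mean; apply/funext => t.
under eq_Rintegral do rewrite (bigD1 l0)//= mulrC.
transitivity ((\prod_(l | l != l0) diag_free f (c l) t) *
  \int[mu]_u diag_free f (c l0) (tupd t (c l0 i0) u)); last first.
  rewrite int_diag_free ?mulr0// => j /cl[]//.
rewrite -intZ; last first.
  apply: (bmeas_comp (bmeas_diag_free (c l0) bf) (h := tupd t (c l0 i0))).
    exact: measurable_tupd1.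
apply: eq_Rintegral => u _; congr (_ * _); apply: eq_bigr => l ll0.
apply: diag_free_tupd_id => i; apply: contraNN ll0 => /eqP /cl[->].
by [].
Qed.

Lemma mean_prod_diag_free_le k n (f : k.-tuple X -> R) (I : finType)
    (c : I -> 'I_k -> 'I_n) (A : {set I}) (s : R) :
  bmeas f -> (forall t, `|f t| <= 1) -> 0 <= s -> mean (fun t => f t ^+ 2) <= s ^+ 2 ->
  (forall a, (#|[set l in A | [exists i, c l i == a]]| <= 2)%N) ->
  `|mean (fun t => \prod_l diag_free f (c l) t)| <= (2 ^ k)%:R ^+ #|I| * s ^+ #|A|.
Proof.
move=> bf f1 s0 fs cA.
pose g l (b : {ffun 'I_k -> bool}) (t : n.-tuple X) : R :=
  if inj_on b (c l) then peval b (fun i => tnth t (c l i)) (fun t => `|f t|) else 0.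
have bg l b : bmeas (g l b).
  rewrite /g; case: (inj_on _ _); last exact: bmeas_cst.
  by apply: bmeas_peval_tnth; exact: bmeas_norm.
have g0 l b t : 0 <= g l b t.
  by rewrite /g; case: ifP => // _; apply: peval_ge0 => ?; rewrite normr_ge0.
have g1 l b t : g l b t <= 1.
  rewrite /g; case: ifP => _ //.
  rewrite -[leRHS](peval_cst mu b (fun i => tnth t (c l i))); apply: peval_le => //.
    exact: bmeas_norm.
  exact: bmeas_cst.
have T_le l t : `|diag_free f (c l) t| <= \sum_(b : {ffun 'I_k -> bool}) g l b t.
  rewrite /diag_free big_mkcond /=; apply: le_trans (ler_norm_sum _ _ _) _.
  apply: ler_sum => b _; rewrite /g.
  case: (inj_on b (c l)); rewrite ?normr0// normrM /sgnb normr_prod big1 ?mul1r.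
    exact: peval_norm.
  by move=> i _; case: (b i); rewrite ?normrN normr1.
apply: le_trans (mean_norm _) _.
  by apply: bmeas_prod => l; exact: bmeas_diag_free.
apply: (@le_trans _ _ (mean (fun t => \sum_(B : {ffun I -> {ffun 'I_k -> bool}})
    \prod_l g l (B l) t))).
  apply: mean_le => [||t].
  - by apply: bmeas_norm; apply: bmeas_prod => l; exact: bmeas_diag_free.
  - by apply: bmeas_sum => B; exact: bmeas_prod.
  - rewrite normr_prod -(bigA_distr_bigA (fun l b => g l b t)) /=.
    by apply: ler_prod => l _; rewrite normr_ge0 T_le.
rewrite mean_sum; last by move=> B; exact: bmeas_prod.
apply: (@le_trans _ _ (\sum_(B : {ffun I -> {ffun 'I_k -> bool}}) s ^+ #|A|)).
  apply: ler_sum => B _.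
  apply: (@le_trans _ _ (mean (fun t => \prod_(l in A) g l (B l) t))).
    apply: mean_le => [||t]; [exact: bmeas_prod|exact: bmeas_prod|].
    rewrite (bigID (mem A)) /= ler_piMr ?prodr_ge0// prodr_ile1// => l _.
    by rewrite g0 g1.
  rewrite -(ler_pXn2r (n := 2))// ?nnegrE ?exprn_ge0//; last first.
    by apply: mean_ge0 => t; exact: prodr_ge0.
  apply: le_trans (mean_prod_sqr_le (dep := fun l a => [exists i, c l i == a]) _ _ _ _) _ => //.
    move=> l a t u; rewrite negb_exists => /forallP ca.
    rewrite /g; case: (inj_on _ _) => //; apply: peval_ext => i _.
    by rewrite tnth_tupd /upd (negbTE (ca i)).
  rewrite exprAC -[_ ^+ #|A|]prodr_const; apply: ler_prod => l _.
  rewrite mean_ge0/=; last by move=> t; rewrite sqr_ge0.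
  apply: le_trans fs; rewrite /g; have [injB|_] := boolP (inj_on _ _); last first.
    under eq_fun do rewrite expr0n /=.
    by rewrite mean_cst; apply: mean_ge0 => t; rewrite sqr_ge0.
  rewrite -(mean_peval_inj (bmeasX 2 bf) injB); apply: mean_le => [||t].
  - by apply: bmeasX; apply: bmeas_peval_tnth; exact: bmeas_norm.
  - by apply: bmeas_peval_tnth; exact: bmeasX.
  - apply: le_trans (peval_sqr_le _ _ _ (bmeas_norm bf)) _.
    rewrite [X in peval _ _ X <= _](_ : _ = (fun x => f x ^+ 2))//.
    by apply/funext => x; rewrite real_normK ?num_real.
rewrite sumr_const card_ffun card_ffun card_bool card_ord -[leLHS]mulr_natl.
by rewrite natrX.
Qed.

End MeanInequalities.

Section NonAtomicMeasures.
Context {R : realType} d (X : measurableType d) (mu : probability X R).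
Hypothesis mu_na : non_atomic mu.
Local Open Scope ereal_scope.

Lemma fin_prob (A : set X) : measurable A -> mu A \is a fin_num.
Proof. by move=> mA; exact: fin_num_measure. Qed.

Lemma non_atomic_split (A : set X) : measurable A -> 0 < mu A ->
  exists B, [/\ measurable B, B `<=` A, 0 < mu B & mu B < mu A].
Proof.
move=> mA A0; apply: contrapT => noB; apply: (mu_na (A := A)); split => // B mB BA.
have [B00|B0] := eqVneq (mu B) 0; first by left.
right; apply/eqP; rewrite eq_le le_measure ?inE//= leNgt.
apply/negP => BltA; apply: noB; exists B; split => //.
by rewrite lt_neqAle eq_sym B0 measure_ge0.
Qed.

Lemma non_atomic_null_point (u : X) :
  exists N, [/\ measurable N, mu N = 0 & N u].
Proof.
pose V := [set mu A | A in [set A : set X | measurable A /\ A u]].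
have V0 : 0 <= ereal_inf V by apply: le_ereal_inf_tmp => _ [A _ <-].
have V1 : ereal_inf V <= 1.
  rewrite -(probability_setT mu); apply: ereal_inf_lbound.
  by exists setT => //; split.
have Vfin : ereal_inf V \is a fin_num.
  by rewrite ge0_fin_numE// (le_lt_trans V1)// ltry.
have /choice[A hA] (m : nat) : exists A : set X,
    [/\ measurable A, A u & mu A < ereal_inf V + (m.+1%:R^-1)%:E].
  have m0 : (0 < m.+1%:R^-1 :> R)%R by rewrite invr_gt0.
  have [_ [A [mA Au] <-] ltA] := lb_ereal_inf_adherent m0 Vfin.
  by exists A.
pose N := \bigcap_m A m.
have mN : measurable N by apply: bigcapT_measurable => m; case: (hA m).
have Nu : N u by move=> m _; case: (hA m).
have NV : mu N <= ereal_inf V.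
  apply/lee_addgt0Pr => e e0.
  have [m me] : exists m : nat, (m.+1%:R^-1 < e)%R.
    by exists (Num.truncn e^-1); rewrite invf_plt ?posrE// truncnS_gt.
  case: (hA m) => mA _ Am; apply: (@le_trans _ _ (mu (A m))).
    by apply: le_measure; rewrite ?inE//; exact: bigcap_inf.
  by rewrite (le_trans (ltW Am))// leeD2l// lee_fin ltW.
exists N; split => //; apply: contrapT => /eqP N0.
have Ngt0 : 0 < mu N by rewrite lt_neqAle eq_sym N0 measure_ge0.
have [B [mB BN B0 ltB]] := non_atomic_split mN Ngt0.
have [Bu|Bu] := pselect (B u).
- have : ereal_inf V <= mu B by apply: ereal_inf_lbound; exists B.
  by move=> /(le_trans NV); rewrite leNgt ltB.
- have : ereal_inf V <= mu (N `\` B).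
    by apply: ereal_inf_lbound; exists (N `\` B) => //; split => //; exact: measurableD.
  move=> /(le_trans NV); rewrite leNgt => /negP; apply.
  rewrite measureD//; last by rewrite ltey_eq fin_prob.
  by rewrite setIidr// lteBlDr ?fin_prob// lteDl ?fin_prob.
Qed.

Lemma non_atomic_small (e : R) (A : set X) : (0 < e)%R -> measurable A ->
  0 < mu A -> exists B, [/\ measurable B, B `<=` A, 0 < mu B & mu B <= e%:E].
Proof.
move=> e0 mA A0.
have halves m : exists B, [/\ measurable B, B `<=` A, 0 < mu B &
    (2 ^ m)%:R%:E * mu B <= 1].
  elim: m => [|m [B [mB BA B0 Bm]]].
    by exists A; split => //; rewrite mul1e probability_le1.
  have [C [mC CB C0 ltC]] := non_atomic_split mB B0.
  have mD : measurable (B `\` C) by exact: measurableD.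
  have BCD : mu B = mu C + mu (B `\` C).
    by rewrite (measureDI mu mB mC) (setIidr CB) addeC.
  have D0 : 0 < mu (B `\` C).
    rewrite lt_neqAle measure_ge0 andbT eq_sym; apply/eqP => D0.
    by move: ltC; rewrite BCD D0 adde0 ltxx.
  have key (E : set X) : measurable E -> mu E + mu E <= mu B ->
      (2 ^ m.+1)%:R%:E * mu E <= 1.
    move=> mE EB; apply: le_trans Bm.
    rewrite expnS mul2n -addnn natrD EFinD ge0_muleDl ?lee_fin ?ler0n//.
    by rewrite -ge0_muleDr// lee_wpmul2l// lee_fin ler0n.
  have [CD|DC] := leP (mu C) (mu (B `\` C)).
  - exists C; split => //; first exact: subset_trans BA.
    by apply: key => //; rewrite BCD leeD2l.
  - exists (B `\` C); split => //; first by apply: subset_trans BA; exact: subDsetl.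
    by apply: key => //; rewrite BCD leeD2r// ltW.
have [m me] : exists m, (e^-1 <= (2 ^ m)%:R)%R.
  exists (Num.truncn e^-1).+1; apply/ltW/(lt_le_trans (truncnS_gt _)).
  by rewrite ler_nat ltnW// ltn_expl.
have [B [mB BA B0 Bm]] := halves m; exists B; split => //.
rewrite -(fineK (fin_prob mB)) lee_fin.
move: Bm B0; rewrite -(fineK (fin_prob mB)) -EFinM lee_fin lte_fin => Bm B0.
have := le_trans (ler_wpM2r (ltW B0) me) Bm.
by rewrite mulrC ler_pdivrMr// mul1r.
Qed.

Lemma small_cover (e : R) : (0 < e)%R -> exists A : nat -> set X,
  [/\ forall m, measurable (A m), trivIset setT A, \bigcup_m A m = setT &
      forall m, mu (A m) <= e%:E].
Proof.
move=> e0.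
pose adm (S B : set X) := [/\ measurable B, B `<=` S & mu B <= e%:E].
have adm0 S : adm S set0 by split => //; rewrite measure0 lee_fin ltW.
have /choice[g gP] (S : set X) : exists B, adm S B /\
    forall C, adm S C -> mu C <= 2%:E * mu B.
  pose V := [set fine (mu B) | B in adm S].
  have supV : has_sup V.
    split; first by exists (fine (mu set0)); exists set0.
    exists 1%R => _ [B [mB _ _] <-].
    by rewrite -lee_fin fineK ?fin_prob// probability_le1.
  have Vub C : adm S C -> (fine (mu C) <= sup V)%R.
    by move=> aC; apply: (ub_le_sup supV.2); exists C.
  have [s0|s0] := leP (sup V) 0%R.
    exists set0; split => // C aC; rewrite measure0 mule0.
    have := Vub _ aC; case: aC => mC _ _ /le_trans /(_ s0).
    by rewrite -lee_fin fineK ?fin_prob.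
  have s20 : (0 < sup V / 2)%R by rewrite divr_gt0.
  have [_ [B aB <-] sB] := sup_adherent s20 supV.
  exists B; split => // C aC; have := Vub _ aC.
  case: aC => mC _ _; case: aB => mB _ _.
  rewrite -(fineK (fin_prob mC)) -(fineK (fin_prob mB)) -EFinM lee_fin => h.
  by move: sB h; lra.
pose fix rest m : set X := if m is m'.+1 then rest m' `\` g (rest m') else setT.
have restP m : measurable (rest m).
  elim: m => //= m IH; apply: measurableD => //.
  by case: (gP (rest m)) => -[].
have mg m : measurable (g (rest m)) by case: (gP (rest m)) => -[].
have gr m : g (rest m) `<=` rest m by case: (gP (rest m)) => -[].
have rest_le m p : rest (m + p)%N `<=` rest m.
  elim: p => [|p IH]; first by rewrite addn0.
  by rewrite addnS /=; apply: subset_trans IH; exact: subDsetl.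
pose N := \bigcap_m rest m.
have mN : measurable N by apply: bigcapT_measurable.
have N0 : mu N = 0.
  apply: contrapT => /eqP N0.
  have Ngt0 : 0 < mu N by rewrite lt_neqAle eq_sym N0 measure_ge0.
  have [B [mB BN B0 Be]] := non_atomic_small e0 mN Ngt0.
  have gB m : mu B <= 2%:E * mu (g (rest m)).
    by case: (gP (rest m)) => _; apply; split => // x /BN; exact.
  have B0' : (0 < fine (mu B))%R by rewrite -lte_fin fineK ?fin_prob.
  have decr m : (fine (mu (rest m)) <= 1 - m%:R * (fine (mu B) / 2))%R.
    elim: m => [|m IH].
      by rewrite mul0r subr0 -lee_fin fineK ?fin_prob// probability_le1.
    have gB' : (fine (mu B) <= 2 * fine (mu (g (rest m))))%R.
      by rewrite -lee_fin EFinM !fineK ?fin_prob.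
    rewrite [rest _]/= measureD//; last by rewrite ltey_eq fin_prob.
    rewrite (setIidr (gr m)) fineB ?fin_prob// -natr1.
    lra.
  have := decr (Num.truncn (2 / fine (mu B))).+1.
  have h := truncnS_gt (2 / fine (mu B))%R.
  have : (1 < (Num.truncn (2 / fine (mu B))).+1%:R * (fine (mu B) / 2))%R.
    by rewrite -ltr_pdivrMr ?divr_gt0// invf_div mul1r.
  have : (0 <= fine (mu (rest (Num.truncn (2 / fine (mu B))).+1)))%R.
    by apply: fine_ge0.
  lra.
exists (fun m => if m is m'.+1 then g (rest m') else N); split.
- by case.
- have dis m p : (m < p)%N -> rest p `&` g (rest m) = set0.
    move=> mp; rewrite -subset0 => x [rx gx].
    by have := @rest_le m.+1 (p - m.+1)%N x; rewrite subnKC// => /(_ rx) [_]; apply.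
  apply: ltn_trivIset => -[//|p] [|m] /= mp; rewrite -subset0 => x.
    by move=> [Nx gx]; have [_] := Nx p.+1 I; apply.
  by move=> [gmx gpx]; rewrite -(dis m p)//; split => //; exact: gr.
- rewrite -subTset => x _; apply: contrapT => nx.
  apply: nx; have [Nx|/existsNP[m /not_implyP[_ nrm]]] := pselect (N x).
    by exists 0%N.
  elim: m nrm => [|m IH] nrm; first by exfalso; apply: nrm.
  have [rm|/IH//] := pselect (rest m x).
  exists m.+1 => //; apply: contrapT => ng; apply: nrm; split => //.
- case=> [|m]; first by rewrite N0 lee_fin ltW.
  by case: (gP (rest m)) => -[].
Qed.

End NonAtomicMeasures.

Section NullSetIntegral.
Context {R : realType} d (X : measurableType d) (mu : probability X R).
Local Open Scope ereal_scope.
Import HBNNSimple.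

Lemma ge0_integral_off_null (h g : X -> \bar R) (N : set X) :
  measurable N -> mu N = 0 -> measurable_fun [set: X] g ->
  (forall x, 0 <= h x) -> (forall x, 0 <= g x) ->
  (forall x, ~ N x -> h x = g x) -> \int[mu]_x h x = \int[mu]_x g x.
Proof.
move=> mN N0 mg h0 g0 hg.
have gN : \int[mu]_x g x = \int[mu]_(x in setT `\` N) g x.
  exact: ge0_negligible_integral.
apply/eqP; rewrite eq_le; apply/andP; split.
- rewrite ge0_integralTE//; apply: ge_ereal_sup => _ [s /= sh <-].
  rewrite -integralT_nnsfun gN (@ge0_negligible_integral _ _ _ mu setT N)//; last 2 first.
    by apply/measurable_EFinP.
    by move=> x _; rewrite lee_fin.
  apply: ge0_le_integral => //.
  + exact: measurableD.
  + by move=> x _; rewrite lee_fin.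
  + by apply/measurable_EFinP; exact: measurable_funTS.
  + exact: measurable_funTS.
  + by move=> x [_ Nx]; rewrite -hg.
- rewrite gN integral_mkcond !ge0_integralTE//; last first.
    by move=> x; exact: erestrict_ge0.
  apply: ereal_sup_le => _ [s /= sg <-]; exists s => //= x.
  apply: le_trans (sg x) _; rewrite patchE; case: ifPn => [|_]//.
  by rewrite inE => -[_ Nx]; rewrite hg.
Qed.

Lemma int_off_null (h g : X -> R) (N : set X) :
  measurable N -> mu N = 0 -> bmeas g ->
  (forall x, ~ N x -> h x = g x) -> (\int[mu]_x h x = \int[mu]_x g x)%R.
Proof.
move=> mN N0 [mg _] hg; rewrite /Rintegral integralE [in RHS]integralE.
have mgE : measurable_fun setT (EFin \o g) by exact/measurable_EFinP.
congr (fine (_ - _)); apply: (ge0_integral_off_null mN N0) => //.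
- exact: measurable_funepos.
- by move=> x Nx; rewrite !funeposE /= hg.
- exact: measurable_funeneg.
- by move=> x Nx; rewrite !funenegE /= hg.
Qed.

End NullSetIntegral.

Section PowerMeasure.
Context {R : realType} d (X : measurableType d) (mu : probability X R).

Definition box n (A : 'I_n -> set X) : set (n.-tuple X) :=
  [set t | forall i, A i (tnth t i)].

Lemma measurable_box n (A : 'I_n -> set X) : (forall i, measurable (A i)) ->
  measurable (box A).
Proof.
move=> mA; rewrite (_ : box A = \bigcap_(i in [set: 'I_n]) ((@tnth n X)^~ i @^-1` A i)).
  apply: fin_bigcap_measurable => // i _.
  by rewrite -[X in measurable X]setTI; exact: measurable_tnth.
by apply/seteqP; split => [t tA i _|t tA i]; exact: tA.
Qed.

Lemma tuple_measurable_box n :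
  @measurable _ (n.-tuple X) =
  <<s [set B | exists2 A : 'I_n -> set X, (forall i, measurable (A i)) & B = box A] >>.
Proof.
apply/seteqP; split.
- apply: smallest_sub; first exact: smallest_sigma_algebra.
  rewrite -bigcup_seq => B [i _ [A mA <-]].
  apply: sub_sigma_algebra; exists (fun j => if j == i then A else setT).
    by move=> j; case: ifP.
  rewrite setTI; apply/seteqP; split => t /=.
    by move=> Ati j; case: eqP => // ->.
  by move=> /(_ i); rewrite eqxx.
- apply: smallest_sub; first exact: sigma_algebra_measurable.
  by move=> B [A mA ->]; exact: measurable_box.
Qed.

Lemma power_measure n : exists nu : probability (n.-tuple X) R,
  (forall A : 'I_n -> set X, (forall i, measurable (A i)) ->
     nu (box A) = (\prod_(i < n) mu (A i))%E) /\
  (forall F : n.-tuple X -> R, bmeas F -> \int[nu]_t F t = mean mu F).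
Proof.
elim: n => [|n [nu [nubox nuF]]].
  exists (\d_([tuple] : 0.-tuple X) : probability _ _); split => [A mA|F [mF _]].
    rewrite big_ord0 /= diracE mem_set//; by case.
  rewrite /Rintegral integral_dirac//; last exact/measurable_EFinP.
  by rewrite diracT mul1e.
pose cns (z : X * n.-tuple X) := [tuple of z.1 :: z.2].
have mcns : measurable_fun setT cns by exact: measurable_cons.
pose cns_mixin := isMeasurableFun.Build _ _ _ _ _ mcns.
pose cns_pack : {mfun _ >-> _} := HB.pack cns cns_mixin.
pose P := (mu \x nu)%E : probability (X * n.-tuple X)%type R.
exists (distribution P cns_pack); split => [A mA|F bF].
- transitivity (P (cns @^-1` box A)); first by [].
  have -> : cns @^-1` box A = A ord0 `*` box (fun i => A (lift ord0 i)).
    apply/seteqP; split => -[x t] /=.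
      by move=> tA; split; [exact: (tA ord0)|move=> i; have := tA (lift ord0 i); rewrite tnthS].
    move=> [Ax tA] i; case: (unliftP ord0 i) => [j ->|->//].
    by rewrite tnthS; exact: tA.
  rewrite [LHS]product_measure1E//; last by apply: measurable_box.
  by rewrite big_ord_recl; congr (_ * _)%E; exact: nubox.
- have bFc : bmeas (fun z : X * n.-tuple X => F [tuple of z.1 :: z.2]).
    exact: bmeas_cons.
  rewrite /Rintegral integral_distribution//; last 2 first.
    by apply/measurable_EFinP; case: bF.
    exact: (bmeas_integrable P bFc).
  rewrite -(integral12_prod_meas1 (bmeas_integrable P bFc)) /mean /=.
  rewrite /Rintegral; congr fine; apply: eq_integral => u _.
  have bFu : bmeas (fun t : n.-tuple X => F [tuple of u :: t]) by exact: bmeas_cons1.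
  rewrite /fubini_F /= -(bmeas_EFin_int nu bFu).
  by rewrite nuF.
Qed.

End PowerMeasure.

Section IndependentSample.
Context {R : realType} dO dX (Omega : measurableType dO) (X : measurableType dX).
Variables (mu : probability X R) (P : probability Omega R) (n : nat).
Variable xi : 'I_n -> {RV P >-> X}.
Hypothesis xi_indep : mutually_independent xi.
Hypothesis xi_dist : forall j, has_distribution (xi j) mu.

Definition sample (w : Omega) : n.-tuple X := [tuple xi j w | j < n].

Lemma measurable_sample : measurable_fun [set: Omega] sample.
Proof.
apply/measurable_fun_tnthP => i.
rewrite (_ : _ \o _ = xi i); first exact: measurable_funP.
by apply/funext => w /=; rewrite tnth_mktuple.
Qed.

Lemma int_sample (F : n.-tuple X -> R) : bmeas F ->
  \int[P]_w F (sample w) = mean mu F.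
Proof.
move=> bF; have [nu [nubox <-//]] := power_measure mu n.
pose s_mixin := isMeasurableFun.Build _ _ _ _ _ measurable_sample.
pose s_pack : {mfun _ >-> _} := HB.pack sample s_mixin.
have eqP A : measurable A -> distribution P s_pack A = nu A.
  apply: (@measure_unique _ _ _ _ (fun=> setT) (tuple_measurable_box X n)).
  - move=> _ _ [A1 mA1 ->] [A2 mA2 ->]; exists (fun i => A1 i `&` A2 i).
      by move=> i; exact: measurableI.
    apply/seteqP; split => t /=; first by move=> [h1 h2] i; split.
    by move=> h; split => i; case: (h i).
  - move=> _; exists (fun=> setT) => //.
    by apply/seteqP; split.
  - by apply/seteqP; split => // x _; exists 0%N.
  - move=> _ [B mB ->]; transitivity (\prod_(i < n) mu (B i))%E; last by rewrite -nubox.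
    transitivity (P (sample @^-1` box B)); first by [].
    have -> : sample @^-1` box B = \bigcap_(j in [set` [set: 'I_n]%SET]) (xi j @^-1` B j).
      apply/seteqP; split => w /=.
        by move=> h j _; have := h j; rewrite tnth_mktuple.
      by move=> h j; rewrite tnth_mktuple; apply: h; rewrite /= inE.
    rewrite xi_indep//; apply: eq_big => [j|j _]; first by rewrite inE.
    exact: xi_dist.
  - by move=> _; rewrite (le_lt_trans (probability_le1 _ _))// ltry.
rewrite /Rintegral [in RHS](eq_measure_integral (distribution P s_pack)); last first.
  by move=> A mA _; apply/esym/eqP.
rewrite integral_distribution//.
  by apply/measurable_EFinP; case: bF.
exact: (bmeas_integrable P (bmeas_comp bF measurable_sample)).
Qed.

Lemma ties_null (mu_na : non_atomic mu) (e : R) : 0 < e ->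
  exists D : set Omega, [/\ measurable D,
    [set w | exists i j, i != j /\ xi i w = xi j w] `<=` D & (P D <= e%:E)%E].
Proof.
move=> e0; pose e' := e / (n * n).+1%:R.
have e'0 : 0 < e' by rewrite divr_gt0.
have [A [mA tA cA Ae]] := small_cover mu_na e'0.
pose E i j := \bigcup_m (xi i @^-1` A m `&` xi j @^-1` A m).
have mxi i m : measurable (xi i @^-1` A m).
  by rewrite -[X in measurable X]setTI; exact: measurable_funP.
have mE i j : measurable (E i j).
  by apply: bigcupT_measurable => m; exact: measurableI.
have PE i j : i != j -> (P (E i j) <= e'%:E)%E.
  move=> ij.
  have Pm m : P (xi i @^-1` A m `&` xi j @^-1` A m) = (mu (A m) * mu (A m))%E.
    have := xi_indep [set i; j]%SET (A := fun=> A m) (fun _ => mA m).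
    rewrite big_setU1/=; last by rewrite inE.
    rewrite big_set1.
    have -> : P (xi i @^-1` A m) = mu (A m) by exact: xi_dist.
    have -> : P (xi j @^-1` A m) = mu (A m) by exact: xi_dist.
    move=> <-; congr (P _); apply/seteqP; split => w /=.
      by move=> [wi wj] l /=; rewrite !inE => /orP[] /eqP ->.
    by move=> h; split; apply: h; rewrite /= !inE eqxx ?orbT.
  apply: (@le_trans _ _ (\sum_(m <oo) P (xi i @^-1` A m `&` xi j @^-1` A m))%E).
    by apply: measure_sigma_subadditive => // m; exact: measurableI.
  apply: (@le_trans _ _ (\sum_(m <oo) (e'%:E * mu (A m)))%E).
    apply: lee_nneseries => // m _; rewrite Pm.
    by rewrite lee_wpmul2r.
  rewrite nneseriesZl// -[leRHS]mule1 lee_wpmul2l//; first by rewrite lee_fin ltW.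
  rewrite -(measure_semi_bigcup mu)//; last exact: bigcupT_measurable.
  by rewrite cA probability_le1.
pose D := \big[setU/set0]_(p : 'I_n * 'I_n | p.1 != p.2) E p.1 p.2.
exists D; split.
- by apply: bigsetU_measurable.
- move=> w [i [j [ij wij]]]; rewrite /D -bigcup_seq_cond.
  exists (i, j); first by rewrite /= mem_index_enum.
  have : (\bigcup_m A m) (xi i w) by rewrite cA.
  by move=> [m _ Am]; exists m => //; split => //=; rewrite -wij.
- apply: (@le_trans _ _ ((size (index_enum ('I_n * 'I_n)%type))%:R * e')%:E).
    rewrite /D; elim: (index_enum _) => [|p s IH].
      by rewrite big_nil measure0 lee_fin mul0r.
    rewrite big_cons -natr1 mulrDl mul1r addrC EFinD; case: ifPn => pp.
      apply: le_trans; first by apply: measureU2 => //; exact: bigsetU_measurable.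
      by apply: leeD => //; exact: PE.
    by apply: le_trans IH _; rewrite leeDr// lee_fin ltW.
  rewrite lee_fin [index_enum _]unlock -enumT -cardT card_prod card_ord /e' mulrC -mulrA.
  apply: ler_piMr; first exact: ltW.
  by rewrite mulrC ler_pdivrMr// mul1r ler_nat.
Qed.

End IndependentSample.

Section FiniteFunctionCons.
Variable T : finType.

Definition fcons k (a : T) (c : {ffun 'I_k -> T}) : {ffun 'I_k.+1 -> T} :=
  [ffun i => if unlift ord0 i is Some j then c j else a].

Lemma fcons0 k a (c : {ffun 'I_k -> T}) : fcons a c ord0 = a.
Proof. by rewrite ffunE unlift_none. Qed.

Lemma fconsS k a (c : {ffun 'I_k -> T}) i : fcons a c (lift ord0 i) = c i.
Proof. by rewrite ffunE liftK. Qed.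

Lemma fcons_lift k a (c : {ffun 'I_k -> T}) :
  (fun i => fcons a c (lift ord0 i)) = c.
Proof. by apply/funext => i; rewrite fconsS. Qed.

Lemma sum_fcons (V : nmodType) k (F : {ffun 'I_k.+1 -> T} -> V) :
  \sum_c F c = \sum_a \sum_(c : {ffun 'I_k -> T}) F (fcons a c).
Proof.
rewrite pair_big /= (reindex (fun p : T * {ffun 'I_k -> T} => fcons p.1 p.2))//.
exists (fun c : {ffun 'I_k.+1 -> T} =>
    (c ord0, [ffun j : 'I_k => c (lift ord0 j)])) => [[a c] _|c _] /=.
  rewrite fcons0; congr (_, _); apply/ffunP => j.
  by rewrite ffunE fconsS.
apply/ffunP => i; case: (unliftP ord0 i) => [j ->|->]; last by rewrite fcons0.
by rewrite fconsS ffunE.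
Qed.

End FiniteFunctionCons.

Section EmpiricalExpansion.
Context {R : realType} d (X : measurableType d) (mu : probability X R).
Hypothesis mu_na : non_atomic mu.
Variables (n : nat) (x : 'I_n -> X).
Hypotheses (n_gt0 : (0 < n)%N) (x_inj : injective x).
Local Notation peval := (peval mu).

Definition null_set (S : set X) :=
  exists N, [/\ measurable N, mu N = 0%E & S `<=` N].

Lemma null_set0 : null_set set0.
Proof. by exists set0; split => //; rewrite measure0. Qed.

Lemma null_setU S T : null_set S -> null_set T -> null_set (S `|` T).
Proof.
move=> [M [mM M0 SM]] [N [mN N0 TN]]; exists (M `|` N); split.
- exact: measurableU.
- apply/eqP; rewrite eq_le measure_ge0 andbT.
  apply: le_trans; first exact: measureU2.
  by rewrite [X in (X + _)%E]M0 [X in (_ + X)%E]N0 adde0.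
- exact: setUSS.
Qed.

Lemma null_set1 u : null_set [set u].
Proof.
by have [N [mN N0 Nu]] := non_atomic_null_point mu_na u; exists N; split => // _ ->.
Qed.

Lemma null_range : null_set (range x).
Proof.
have -> : range x = \big[setU/set0]_(i <- enum 'I_n) [set x i].
  rewrite -bigcup_seq; apply/seteqP; split => [_ [i _ <-]|u [i _ ->]].
    by exists i => //=; rewrite mem_enum.
  by exists i.
elim: (enum 'I_n) => [|i s IH]; first by rewrite big_nil; exact: null_set0.
by rewrite big_cons; apply: null_setU => //; exact: null_set1.
Qed.

Definition expansion k (S : set X) (f : k.-tuple X -> R) : R :=
  \sum_(c : {ffun 'I_k -> 'I_n}) \sum_(b : {ffun 'I_k -> bool})
    if `[< inj_on b c /\ forall i, b i -> ~ S (x (c i)) >]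
    then sgnb b * peval b (fun i => x (c i)) f else 0.

Lemma bmeas_expansion k (S : set X) (f : k.+1.-tuple X -> R) : bmeas f ->
  bmeas (fun u => expansion S (fun t : k.-tuple X => f [tuple of u :: t])).
Proof.
move=> bf; apply: bmeas_sum => c; apply: bmeas_sum => b.
case: `[< _ >]; last exact: bmeas_cst.
by apply: bmeasZ; exact: bmeas_peval_cons.
Qed.

Lemma expansionS k (S : set X) (f : k.+1.-tuple X -> R) : bmeas f ->
  expansion S f =
  \sum_a (if `[< S (x a) >] then 0 else
    expansion (S `|` [set x a]) (fun t => f [tuple of x a :: t])) -
  n%:R * \int[mu]_u expansion S (fun t => f [tuple of u :: t]).
Proof.
move=> bf; rewrite /expansion sum_fcons.
under eq_bigr do under eq_bigr do rewrite sum_fcons big_bool /=.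
under eq_bigr do rewrite big_split /=.
rewrite big_split /=; congr (_ + _).
- apply: eq_bigr => a _; case: asboolP => Sa.
    apply: big1 => c _; apply: big1 => b _; case: asboolP => // -[_ /(_ ord0)].
    by rewrite !fcons0 => /(_ isT).
  apply: eq_bigr => c _; apply: eq_bigr => b _.
  have -> : `[< inj_on (fcons true b) (fcons a c) /\
      forall i, fcons true b i -> ~ S (x (fcons a c i)) >] =
      `[< inj_on b c /\ forall i, b i -> ~ (S `|` [set x a]) (x (c i)) >].
    apply/asboolP/asboolP => -[/asboolP inj nS].
      split.
        apply/asboolP => i j bi bj cij; apply: (@lift_inj _ ord0).
        by apply: inj; rewrite !fconsS.
      move=> i bi [|/= /x_inj cia].
        by have := nS (lift ord0 i); rewrite !fconsS; exact.
      have := inj ord0 (lift ord0 i); rewrite !fconsS !fcons0 => /(_ isT bi).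
      by rewrite cia => /(_ erefl).
    split.
      apply/asboolP => i j.
      case: (unliftP ord0 i) => [i' ->|->]; case: (unliftP ord0 j) => [j' ->|->] //.
      - by rewrite !fconsS => bi bj cij; congr lift; exact: inj.
      - rewrite !fconsS !fcons0 => bi _ cia; have := nS _ bi.
        by rewrite cia => /not_orP[_] /(_ erefl).
      - rewrite !fconsS !fcons0 => _ bi cia; have := nS _ bi.
        by rewrite -cia => /not_orP[_] /(_ erefl).
    move=> i; case: (unliftP ord0 i) => [i' ->|->]; last by rewrite !fcons0.
    by rewrite !fconsS => bi; have /not_orP[] := nS _ bi.
  case: `[< _ >] => //; rewrite fcons0; congr (_ * _).
    rewrite /sgnb big_ord_recl fcons0 mul1r.
    by apply: eq_bigr => i _; rewrite fconsS.
  rewrite fcons0 fcons_lift; congr (peval _ _ _).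
  by apply/funext => i; rewrite fconsS.
- rewrite int_sum; last first.
    move=> c; apply: bmeas_sum => b; case: `[< _ >]; last exact: bmeas_cst.
    by apply: bmeasZ; exact: bmeas_peval_cons.
  set G := (X in n%:R * X); transitivity (\sum_(a < n) - G); last first.
    by rewrite sumr_const card_ord mulNrn mulr_natl.
  apply: eq_bigr => a _; rewrite /G -sumrN; apply: eq_bigr => c _.
  rewrite int_sum; last first.
    move=> b; case: `[< _ >]; last exact: bmeas_cst.
    by apply: bmeasZ; exact: bmeas_peval_cons.
  rewrite -sumrN; apply: eq_bigr => b _.
  have -> : `[< inj_on (fcons false b) (fcons a c) /\
      forall i, fcons false b i -> ~ S (x (fcons a c i)) >] =
      `[< inj_on b c /\ forall i, b i -> ~ S (x (c i)) >].
    apply/asboolP/asboolP => -[/asboolP inj nS]; split.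
    + apply/asboolP => i j bi bj cij; apply: (@lift_inj _ ord0).
      by apply: inj; rewrite !fconsS.
    + by move=> i bi; have := nS (lift ord0 i); rewrite !fconsS; exact.
    + apply/asboolP => i j.
      case: (unliftP ord0 i) => [i' ->|->]; last by rewrite !fcons0.
      case: (unliftP ord0 j) => [j' ->|->]; last by rewrite !fcons0.
      by rewrite !fconsS => bi bj cij; congr lift; exact: inj.
    + move=> i; case: (unliftP ord0 i) => [i' ->|->]; last by rewrite !fcons0.
      by rewrite !fconsS; exact: nS.
  case: `[< _ >]; last by rewrite int_cst oppr0.
  rewrite intZ; last exact: bmeas_peval_cons.
  rewrite -mulNr fcons0; congr (_ * _).
    rewrite /sgnb big_ord_recl fcons0 mulN1r; congr (- _).
    by apply: eq_bigr => i _; rewrite fconsS.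
  apply: eq_Rintegral => u _; congr (peval _ _ _).
    by rewrite fcons_lift.
  by apply/funext => i; rewrite fconsS.
Qed.

Lemma expansion_off_null k (S : set X) u (f : k.-tuple X -> R) :
  ~ range x u -> expansion (S `|` [set u]) f = expansion S f.
Proof.
move=> xu; apply: eq_bigr => c _; apply: eq_bigr => b _.
congr (if _ then _ else _); apply/asboolP/asboolP => -[inj nS]; split => // i bi.
  by have /not_orP[] := nS i bi.
by move=> [/nS|/= xcu]; [exact|apply: xu; exists (c i)].
Qed.

Lemma expansion0 k (S : set X) : expansion S (fun _ : k.-tuple X => 0) = 0.
Proof.
apply: big1 => c _; apply: big1 => b _.
by rewrite peval_cst mulr0; case: ifP.
Qed.

Lemma iterated_empirical k (S : set X) (f : k.-tuple X -> R) :
  null_set S -> bmeas f ->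
  iterated_integral (integral_empirical_minus mu x) (fun t =>
    if `[< off_diagonal t /\ forall i, ~ S (tnth t i) >] then f t else 0) =
  n%:R ^- k * expansion S f.
Proof.
elim: k S f => [|k IH] S f nS bf /=.
  rewrite asboolT; last by split => [[]|[]].
  rewrite expr0 invr1 mul1r /expansion.
  apply/esym; transitivity (\sum_(c : {ffun 'I_0 -> 'I_n})
      \sum_(b : {ffun 'I_0 -> bool}) f [tuple]).
    apply: eq_bigr => c _; apply: eq_bigr => b _.
    rewrite asboolT; last by split; [apply/asboolP => -[]|case].
    by rewrite /sgnb big_ord0 mul1r.
  by rewrite !sumr_const !card_ffun !card_ord !expn0 !mulr1n.
have inner u : iterated_integral (integral_empirical_minus mu x) (fun t : k.-tuple X =>
    if `[< off_diagonal [tuple of u :: t] /\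
           forall i, ~ S (tnth [tuple of u :: t] i) >]
    then f [tuple of u :: t] else 0) =
    if `[< S u >] then 0 else
    n%:R ^- k * expansion (S `|` [set u]) (fun t => f [tuple of u :: t]).
  case: asboolP => Su.
    rewrite -[RHS](mulr0 (n%:R ^- k)) -(expansion0 k set0).
    rewrite -(IH set0 (fun=> 0) null_set0 (bmeas_cst _ _)).
    congr iterated_integral; apply/funext => t.
    rewrite asboolF; last by move=> [_ /(_ ord0)].
    by rewrite expansion0; case: `[< _ >].
  rewrite -IH; last 2 first.
    by apply: null_setU => //; exact: null_set1.
    exact: bmeas_cons1.
  congr iterated_integral; apply/funext => t.
  congr (if _ then _ else _); apply/asboolP/asboolP => -[od nSt]; split.
  - by move=> i j ij; have := od (lift ord0 i) (lift ord0 j); rewrite !tnthS; exact.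
  - move=> i [|/= tu]; first by have := nSt (lift ord0 i); rewrite tnthS.
    have := od ord0 (lift ord0 i); rewrite tnthS => /(_ isT).
    by rewrite tu; exact.
  - move=> i j; case: (unliftP ord0 j) => [j' ->|->]; last by rewrite ltn0.
    case: (unliftP ord0 i) => [i' ->|->].
      by rewrite !tnthS => ij; exact: od.
    rewrite tnthS => _ e; have /not_orP[_] := nSt j'; apply.
    by rewrite /= -e.
  - move=> i; case: (unliftP ord0 i) => [i' ->|->]; last by [].
    by rewrite tnthS; have /not_orP[] := nSt i'.
rewrite [X in integral_empirical_minus mu x X](_ : _ = (fun u =>
    if `[< S u >] then 0 else
    n%:R ^- k * expansion (S `|` [set u]) (fun t => f [tuple of u :: t]))); last first.
  by apply/funext => u; exact: inner.
rewrite /integral_empirical_minus integral_empirical.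
have [N [mN N0 SN]] := null_setU nS null_range.
rewrite (int_off_null (N := N) (g := fun u => n%:R ^- k *
    expansion S (fun t => f [tuple of u :: t])))//; last 2 first.
- by apply: bmeasZ; exact: bmeas_expansion.
- move=> u Nu; rewrite asboolF; last by move=> Su; apply: Nu; apply: SN; left.
  by rewrite expansion_off_null// => xu; apply: Nu; apply: SN; right.
rewrite intZ; last exact: bmeas_expansion.
rewrite expansionS// mulrBr; congr (_ - _).
  rewrite !mulr_sumr; apply: eq_bigr => a _; case: ifP => _; first by rewrite !mulr0.
  by rewrite mulrA -invfM -exprS.
rewrite mulrA; congr (_ * _); rewrite exprS invfM mulrC mulrA divff ?mul1r//.
by rewrite pnatr_eq0 -lt0n.
Qed.

Lemma J_expansion k (f : k.-tuple X -> R) : bmeas f ->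
  J mu x f = n%:R `^ (k%:R / 2) / k`!%:R * (n%:R ^- k *
    \sum_(c : {ffun 'I_k -> 'I_n}) diag_free mu f c [tuple x j | j < n]).
Proof.
move=> bf; rewrite /J; congr (_ * _).
have := iterated_empirical null_set0 bf; rewrite /expansion => h.
rewrite (_ : f \_ _ = (fun t =>
    if `[< off_diagonal t /\ forall i, ~ set0 (tnth t i) >] then f t else 0)).
  rewrite h; congr (_ * _); apply: eq_bigr => c _; rewrite [RHS]big_mkcond /=.
  apply: eq_bigr => b _; rewrite (_ : `[< _ >] = inj_on b c); last first.
    by apply/asboolP/idP => [[]//|H]; split => // i _ [].
  case: (inj_on b c) => //; congr (_ * _); congr (peval _ _ _).
  by apply/funext => i; rewrite tnth_mktuple.
apply/funext => t; rewrite patchE; congr (if _ then _ else _).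
apply/idP/asboolP; first by rewrite inE => od; split => // i [].
by move=> [od _]; rewrite inE.
Qed.

End EmpiricalExpansion.

(* In every fiber of [phi] two points are kept; a row containing a point that is
   not kept is discarded. *)
Lemma two_per_fiber (P T I : finType) (phi : P -> T) (row : P -> I) (p0 : P) :
  (forall p, exists2 p', p' != p & phi p' = phi p) ->
  (2 * #|[set phi p | p : P]%SET| <= #|P|)%N /\
  exists A : {set I},
    (#|I| + 2 * #|[set phi p | p : P]%SET| <= #|A| + #|P|)%N /\
    forall a, (#|[set l in A | [exists p, (row p == l) && (phi p == a)]]| <= 2)%N.
Proof.
move=> two; set im := [set phi p | p : P]%SET.
have /choice[q qP] (a : T) : exists q : P * P, a \in im ->
    [/\ phi q.1 = a, phi q.2 = a & q.1 != q.2].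
  have [/imsetP[p _ ->]|_] := boolP (a \in im); last by exists (p0, p0).
  by have [p' pp' e] := two p; exists (p', p).
pose K := ([set (q a).1 | a in im] :|: [set (q a).2 | a in im])%SET.
have cK : #|K| = (2 * #|im|)%N.
  rewrite cardsU (_ : _ :&: _ = finset.set0); last first.
    apply/finset.setP => p; rewrite !inE; apply/negP => /andP[].
    move=> /imsetP[a aim ->] /imsetP[b bim e].
    have [a1 a2 a12] := qP a aim; have [b1 b2 b12] := qP b bim.
    have ab : a = b by rewrite -a1 e b2.
    by move: a12; rewrite e ab eqxx.
  have c1 : #|[set (q a).1 | a in im]%SET| = #|im|.
    apply: card_in_imset => a b aim bim e.
    by have [a1 _ _] := qP a aim; have [b1 _ _] := qP b bim; rewrite -a1 e.
  have c2 : #|[set (q a).2 | a in im]%SET| = #|im|.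
    apply: card_in_imset => a b aim bim e.
    by have [_ a2 _] := qP a aim; have [_ b2 _] := qP b bim; rewrite -a2 e.
  by rewrite cards0 subn0 c1 c2 addnn mul2n.
split; first by rewrite -cK max_card.
exists (~: (row @: (~: K)))%SET; split.
  have h1 : (#|row @: (~: K)%SET| + #|~: (row @: (~: K))%SET|)%N = #|I|.
    exact: cardsC.
  have h2 : (#|K| + #|(~: K)%SET|)%N = #|P| by exact: cardsC.
  have h3 : (#|row @: (~: K)%SET| <= #|(~: K)%SET|)%N by exact: leq_imset_card.
  move: h1 h2 h3; rewrite -cK.
  move: #|row @: (~: K)%SET| #|~: (row @: (~: K))%SET| #|(~: K)%SET| => x y z.
  by move: #|K| #|P| #|I| => u v w; lia.
move=> a; apply: (@leq_trans #|[set row (q a).1; row (q a).2]%SET|); last first.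
  by rewrite cards2; case: eqP.
apply: subset_leq_card; apply/fintype.subsetP => l; rewrite !inE.
move=> /andP[lA /existsP[p /andP[/eqP rp /eqP pa]]].
have pK : p \in K.
  by apply: contraNT lA => pK; apply/imsetP; exists p; [rewrite finset.in_setC|rewrite rp].
move: pK; rewrite inE => /orP[] /imsetP[b /qP[b1 b2 _] pb].
- by move: pa; rewrite pb b1 => ba; rewrite -rp pb ba eqxx.
- by move: pa; rewrite pb b2 => ba; rewrite -rp pb ba eqxx orbT.
Qed.

Section MomentBound.
Context {R : realType} d (X : measurableType d) (mu : probability X R).
Variables (k n : nat) (f : k.-tuple X -> R) (s : R).
Hypotheses (bf : bmeas f) (f1 : forall t, `|f t| <= 1).
Hypotheses (s0 : 0 < s) (s1 : s <= 1) (fs : mean mu (fun t => f t ^+ 2) <= s ^+ 2).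
Hypothesis k_gt0 : (0 < k)%N.

Definition used_values m (C : {ffun 'I_m -> {ffun 'I_k -> 'I_n}}) : {set 'I_n} :=
  [set C p.1 p.2 | p : 'I_m * 'I_k]%SET.

Lemma weight_ge0 (a b c : nat) : 0 <= 4 ^+ a * s ^+ b / (s ^+ 2) ^+ c.
Proof.
have s_ge0 := ltW s0.
by apply: divr_ge0; [apply: mulr_ge0|]; do ?apply: exprn_ge0.
Qed.

Lemma mean_diag_free_le M (C : {ffun 'I_M.+1.*2 -> {ffun 'I_k -> 'I_n}}) :
  `|mean mu (fun t => \prod_l diag_free mu f (C l) t)| <=
  if (#|used_values C| <= M.+1 * k)%N then
    4 ^+ (M.+1 * k) * s ^+ M.+1.*2 / (s ^+ 2) ^+ (M.+1 * k - #|used_values C|)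
  else 0.
Proof.
pose phi := fun p : 'I_M.+1.*2 * 'I_k => C p.1 p.2.
have rhs0 b : 0 <= 4 ^+ (M.+1 * k) * s ^+ M.+1.*2 / (s ^+ 2) ^+ b.
  exact: weight_ge0.
have [[p single]|two] := pselect (exists p, forall p', phi p' = phi p -> p' = p).
  rewrite (mean_prod_diag_free_eq0 mu (l0 := p.1) (i0 := p.2) bf).
    by rewrite normr0; case: ifP.
  by move=> l i e; have <- := single (l, i) e.
have [|U [A [AU A2]]] := @two_per_fiber _ _ _ phi fst (ord0, Ordinal k_gt0).
  move=> p; apply: contrapT => np; apply: two; exists p => p' e.
  by apply/eqP/negPn/negP => pp'; apply: np; exists p'.
have cP : #|{: 'I_M.+1.*2 * 'I_k}| = (2 * (M.+1 * k))%N.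
  by rewrite card_prod !card_ord -mul2n mulnA.
have {}U : (2 * #|used_values C| <= 2 * (M.+1 * k))%N by rewrite -cP.
have {}AU : (M.+1.*2 + 2 * #|used_values C| <= #|A| + 2 * (M.+1 * k))%N.
  by rewrite -cP -[X in (X + _)%N](card_ord M.+1.*2).
have BL : (#|used_values C| <= M.+1 * k)%N by move: U; rewrite leq_pmul2l.
rewrite BL.
have := @mean_prod_diag_free_le _ _ X mu k n f _ (fun l => C l) A s bf f1 (ltW s0) fs.
rewrite card_ord => h; apply: le_trans (h _) _.
  move=> a; apply: leq_trans (A2 a); apply: subset_leq_card.
  apply/fintype.subsetP => l; rewrite !inE => /andP[-> /existsP[i ci]].
  by apply/existsP; exists (l, i); rewrite eqxx.
have -> : (2 ^ k)%:R ^+ M.+1.*2 = 4 ^+ (M.+1 * k) :> R.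
  have -> : 4 = 2 ^+ 2 :> R by rewrite expr2 -natrM.
  by rewrite natrX -!exprM -mul2n mulnCA [(k * _)%N]mulnC.
rewrite -mulrA ler_wpM2l ?exprn_ge0// ler_pdivlMr ?exprn_gt0//.
rewrite -exprM -exprD ler_wiXn2l ?(ltW s0)//.
by move: AU BL; move: #|used_values C| #|A| (M.+1 * k)%N => u v w; lia.
Qed.

Lemma expn_le_fact (B : nat) : B%:R ^+ B <= expR 1 ^+ B * B`!%:R :> R.
Proof.
case: B => [|B]; first by rewrite !expr0 mul1r.
have := @expR_ge1Dxn R B.+1%:R B (ler0n _ _).
rewrite -[X in expR X]mulr1 expRM_natl => h.
rewrite -ler_pdivrMr ?ltr0n ?fact_gt0//.
by move: h; lra.
Qed.

Lemma card_values_subset m (S : {set 'I_n}) :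
  #|[pred C : {ffun 'I_m -> {ffun 'I_k -> 'I_n}} | used_values C \subset S]| =
  (#|S| ^ (m * k))%N.
Proof.
rewrite -(@eq_card _ (ffun_on (ffun_on (mem S)))).
  rewrite !card_ffun_on !card_ord.
  by rewrite -expnM mulnC.
move=> C; rewrite inE; apply/ffun_onP/fintype.subsetP.
- move=> CS _ /imsetP[p _ ->]; have /ffun_onP := CS p.1; exact.
- by move=> CS l; apply/ffun_onP => i; apply: CS; apply/imsetP; exists (l, i).
Qed.

Lemma mean_power_le M L : L = (M.+1 * k)%N -> L%:R <= n%:R * s ^+ 2 ->
  mean mu (fun t => (n%:R ^- k * \sum_(c : {ffun 'I_k -> 'I_n}) diag_free mu f c t)
    ^+ M.+1.*2) <= (8 * expR 1 * L%:R) ^+ L * s ^+ M.+1.*2 / n%:R ^+ L.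
Proof.
move=> LE Ln.
have L0 : (0 < L)%N by rewrite LE muln_gt0 k_gt0.
have ns0 : 0 < n%:R * s ^+ 2 :> R by apply: lt_le_trans Ln; rewrite ltr0n.
have n0 : 0 < n%:R :> R by move: ns0; rewrite pmulr_lgt0// exprn_gt0.
pose W (B : nat) : R := 4 ^+ L * s ^+ M.+1.*2 / (s ^+ 2) ^+ (L - B).
have s_ge0 := ltW s0.
have W0 B : 0 <= W B by exact: weight_ge0.
have sM0 : 0 <= s ^+ M.+1.*2 by exact: exprn_ge0.
have step1 : mean mu (fun t => (\sum_(c : {ffun 'I_k -> 'I_n}) diag_free mu f c t)
    ^+ M.+1.*2) <= \sum_(S : {set 'I_n} | (#|S| <= L)%N) (#|S| ^ (2 * L))%:R * W #|S|.
  have -> : (fun t => (\sum_(c : {ffun 'I_k -> 'I_n}) diag_free mu f c t) ^+ M.+1.*2) =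
      (fun t => \sum_(C : {ffun 'I_M.+1.*2 -> {ffun 'I_k -> 'I_n}})
        \prod_l diag_free mu f (C l) t).
    apply/funext => t; rewrite -(bigA_distr_bigA
      (fun (l : 'I_M.+1.*2) (c : {ffun 'I_k -> 'I_n}) => diag_free mu f c t)) /=.
    by rewrite prodr_const card_ord.
  rewrite mean_sum; last by move=> C; apply: bmeas_prod => l; exact: bmeas_diag_free.
  apply: (@le_trans _ _ (\sum_(C : {ffun 'I_M.+1.*2 -> {ffun 'I_k -> 'I_n}})
      \sum_(S : {set 'I_n} | (#|S| <= L)%N) if used_values C \subset S then W #|S| else 0)).
    apply: ler_sum => C _; apply: le_trans (ler_norm _) _.
    have := mean_diag_free_le C; rewrite -LE => /le_trans; apply.
    have S0 (S : {set 'I_n}) : 0 <= if used_values C \subset S then W #|S| else 0.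
      by case: ifP.
    case: ifP => [BL|_]; last by apply: sumr_ge0 => S _; exact: S0.
    rewrite (bigD1 (used_values C))//= subxx lerDl.
    by apply: sumr_ge0 => S _; exact: S0.
  rewrite exchange_big /=; apply: ler_sum => S _.
  rewrite -big_mkcond sumr_const mulr_natl card_values_subset.
  have -> : (M.+1.*2 * k = 2 * L)%N by rewrite LE -mul2n mulnA.
  by [].
have step2 : \sum_(S : {set 'I_n} | (#|S| <= L)%N) (#|S| ^ (2 * L))%:R * W #|S| =
    \sum_(B < L.+1) 'C(n, B)%:R * ((B ^ (2 * L))%:R * W B).
  rewrite (partition_big (fun S : {set 'I_n} => inord #|S| : 'I_L.+1) predT)//=.
  apply: eq_bigr => B _.
  have e (S : {set 'I_n}) :
      ((#|S| <= L)%N && (inord #|S| == B)) = (S \in [set S : {set 'I_n} | #|S| == B]%SET).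
    rewrite inE; apply/andP/eqP => [[SL /eqP <-]|SB]; first by rewrite inordK.
    by rewrite SB -ltnS ltn_ord; split => //; apply/eqP/val_inj; rewrite /= inordK.
  rewrite (eq_bigl _ _ e) (eq_bigr (fun=> (B ^ (2 * L))%:R * W B)); last first.
    by move=> S; rewrite inE => /eqP ->.
  by rewrite sumr_const card_draws card_ord [RHS]mulr_natl.
have step3 (B : nat) : (B <= L)%N ->
    'C(n, B)%:R * ((B ^ (2 * L))%:R * W B) <=
    n%:R ^+ L * (4 ^+ L * s ^+ M.+1.*2 * (expR 1 ^+ L * L%:R ^+ L)).
  move=> BL.
  have cn : 'C(n, B)%:R * B`!%:R <= n%:R ^+ B :> R.
    rewrite -natrM bin_ffact -natrX ler_nat.
    rewrite ffact_prod -[B in (_ <= _ ^ B)%N]card_ord -prod_nat_const.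
    by apply: leq_prod => i _; exact: leq_subr.
  have B0 : 0 <= B%:R :> R by [].
  have BLr : B%:R <= L%:R :> R by rewrite ler_nat.
  set z := (s ^+ 2) ^+ (L - B).
  have z0 : 0 < z by rewrite !exprn_gt0.
  have zL : L%:R ^+ (L - B) <= n%:R ^+ (L - B) * z :> R.
    by rewrite -exprMn lerXn2r ?nnegrE// ltW.
  have e1 : 1 <= expR 1 :> R by rewrite -expR0 ler_expR.
  have eB : expR 1 ^+ B <= expR 1 ^+ L :> R by rewrite ler_weXn2l.
  have eL0 : 0 <= expR 1 ^+ L :> R by rewrite exprn_ge0// expR_ge0.
  rewrite /W -/z natrX.
  have -> : 'C(n, B)%:R * (B%:R ^+ (2 * L) * (4 ^+ L * s ^+ M.+1.*2 / z)) =
      (4 ^+ L * s ^+ M.+1.*2) * ('C(n, B)%:R * B%:R ^+ (2 * L) / z) by ring.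
  rewrite [leRHS]mulrCA ler_wpM2l//; first by rewrite mulr_ge0// exprn_ge0.
  rewrite ler_pdivrMr//.
  have -> : B%:R ^+ (2 * L) = B%:R ^+ B * (B%:R ^+ (L - B) * B%:R ^+ L) :> R.
    have -> : (2 * L = B + ((L - B) + L))%N by rewrite addnA subnKC// mul2n addnn.
    by rewrite !exprD.
  apply: (@le_trans _ _ ('C(n, B)%:R * ((expR 1 ^+ L * B`!%:R) *
      (L%:R ^+ (L - B) * L%:R ^+ L)))).
    rewrite ler_wpM2l//; apply: ler_pM; rewrite ?mulr_ge0 ?exprn_ge0//.
      by apply: le_trans (expn_le_fact B) _; rewrite ler_wpM2r.
    by apply: ler_pM; rewrite ?exprn_ge0// lerXn2r ?nnegrE.
  have perm1 (a b c e l : R) : a * (b * c * (e * l)) = b * l * (a * c * e) by ring.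
  have perm2 (a b c e : R) : a * b * c * e = c * (a * (b * e)) by ring.
  have nL : n%:R ^+ L = n%:R ^+ B * n%:R ^+ (L - B) :> R.
    by rewrite -exprD subnKC.
  rewrite perm1 nL perm2.
  rewrite ler_wpM2l ?mulr_ge0 ?exprn_ge0//.
  by apply: ler_pM => //; rewrite ?mulr_ge0 ?exprn_ge0.
have bS : bmeas (fun t => (\sum_(c : {ffun 'I_k -> 'I_n}) diag_free mu f c t) ^+ M.+1.*2).
  by apply: bmeasX; apply: bmeas_sum => c; exact: bmeas_diag_free.
under eq_fun do rewrite exprMn.
rewrite meanZ// -exprVn -exprM.
have -> : (k * M.+1.*2)%N = (2 * L)%N by rewrite LE -mul2n; ring.
apply: (@le_trans _ _ (n%:R^-1 ^+ (2 * L) * (L.+1%:R *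
    (n%:R ^+ L * (4 ^+ L * s ^+ M.+1.*2 * (expR 1 ^+ L * L%:R ^+ L)))))).
  rewrite ler_wpM2l ?exprn_ge0 ?invr_ge0//.
  apply: le_trans step1 _; rewrite step2.
  rewrite -[L.+1 in leRHS]card_ord mulr_natl -sumr_const.
  by apply: ler_sum => B _; apply: step3; rewrite -ltnS.
have L2 : L.+1%:R <= 2 ^+ L :> R by rewrite -natrX ler_nat ltn_expl.
rewrite [leLHS](_ : _ = L.+1%:R * ((4 * expR 1 * L%:R) ^+ L * s ^+ M.+1.*2 / n%:R ^+ L)).
  rewrite [leRHS](_ : _ = 2 ^+ L * ((4 * expR 1 * L%:R) ^+ L * s ^+ M.+1.*2 / n%:R ^+ L)).
    rewrite ler_wpM2r// divr_ge0 ?exprn_ge0 ?(ltW n0)//.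
    by rewrite mulr_ge0// exprn_ge0// mulr_ge0// mulr_ge0// expR_ge0.
  have -> : 8 * expR 1 * L%:R = 2 * (4 * expR 1 * L%:R) :> R.
    by rewrite !mulrA -natrM.
  by rewrite exprMn -!mulrA.
have perm3 (q a b c e l : R) : q != 0 ->
    q^-1 * q^-1 * (a * (q * (b * c * (e * l)))) = a * (b * e * l * c / q).
  by move=> q0; field.
by rewrite mul2n -addnn exprD !exprMn exprVn perm3// expf_neq0// gt_eqF.
Qed.

End MomentBound.

Section Tail.
Context {R : realType} d (X : measurableType d) (mu : probability X R).
Variables (k n : nat) (f : k.-tuple X -> R).
Hypotheses (bf : bmeas f) (f1 : forall t, `|f t| <= 1) (k_gt0 : (0 < k)%N)
  (n_gt0 : (0 < n)%N).

Lemma diag_free_norm_le (c : 'I_k -> 'I_n) (t : n.-tuple X) :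
  `|diag_free mu f c t| <= 2 ^+ k.
Proof.
rewrite /diag_free big_mkcond /=; apply: le_trans (ler_norm_sum _ _ _) _.
apply: (@le_trans _ _ (\sum_(b : {ffun 'I_k -> bool}) 1)); last first.
  by rewrite sumr_const card_ffun card_bool card_ord natrX.
apply: ler_sum => b _; case: (inj_on b c); last by rewrite normr0.
rewrite normrM /sgnb normr_prod big1 ?mul1r; last first.
  by move=> i _; case: (b i); rewrite ?normrN normr1.
apply: le_trans (peval_norm _ _ _ bf) _.
rewrite -[leRHS](peval_cst mu b (fun i => tnth t (c i))); apply: peval_le => //.
  exact: bmeas_norm.
exact: bmeas_cst.
Qed.

Definition J_sum (t : n.-tuple X) : R :=
  n%:R `^ (k%:R / 2) / k`!%:R *
  (n%:R ^- k * \sum_(c : {ffun 'I_k -> 'I_n}) diag_free mu f c t).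

Lemma bmeas_J_sum : bmeas J_sum.
Proof.
by do 2 apply: bmeasZ; apply: bmeas_sum => c; exact: bmeas_diag_free.
Qed.

Lemma powR_half_sqr : (n%:R `^ (k%:R / 2)) ^+ 2 = n%:R ^+ k :> R.
Proof.
rewrite -powR_mulrn ?powR_ge0// -powRrM divfK ?pnatr_eq0//.
by rewrite powR_mulrn.
Qed.

Lemma J_sum_scale_le M : (n%:R `^ (k%:R / 2) / k`!%:R) ^+ M.*2 <= n%:R ^+ (M * k) :> R.
Proof.
have k1 : 1 <= k`!%:R :> R by rewrite ler1n fact_gt0.
have p0 : 0 <= n%:R `^ (k%:R / 2) :> R by exact: powR_ge0.
apply: (@le_trans _ _ ((n%:R `^ (k%:R / 2)) ^+ M.*2)).
  apply: lerXn2r; rewrite ?nnegrE ?divr_ge0//.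
  by rewrite ler_pdivrMr ?(lt_le_trans ltr01)// ler_peMr.
by rewrite -mul2n exprM powR_half_sqr -exprM mulnC.
Qed.

Lemma mean_J_sum_le (s : R) M L : 0 < s -> mean mu (fun t => f t ^+ 2) <= s ^+ 2 ->
  L = (M.+1 * k)%N -> L%:R <= n%:R * s ^+ 2 ->
  mean mu (fun t => J_sum t ^+ M.+1.*2) <=
  (8 * expR 1 * L%:R) ^+ L * s ^+ M.+1.*2.
Proof.
move=> s0 fs LE Ln.
have L0 : (0 < L)%N by rewrite LE muln_gt0 k_gt0.
have nr0 : 0 < n%:R :> R by rewrite ltr0n.
have e1 : 1 <= expR 1 :> R by rewrite -expR0 ler_expR.
pose a : R := (n%:R `^ (k%:R / 2) / k`!%:R) ^+ M.+1.*2.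
have aL : a <= n%:R ^+ L by rewrite LE; exact: J_sum_scale_le.
have a0 : 0 <= a by rewrite exprn_ge0// divr_ge0// powR_ge0.
pose G (t : n.-tuple X) : R :=
  n%:R ^- k * \sum_(c : {ffun 'I_k -> 'I_n}) diag_free mu f c t.
have bG : bmeas G.
  by apply: bmeasZ; apply: bmeas_sum => c; exact: bmeas_diag_free.
have -> : mean mu (fun t => J_sum t ^+ M.+1.*2) =
    a * mean mu (fun t => G t ^+ M.+1.*2).
  rewrite -meanZ; last exact: bmeasX.
  by congr (mean _ _); apply/funext => t; rewrite /J_sum exprMn.
have K0 : 0 <= (8 * expR 1 * L%:R) ^+ L :> R.
  by rewrite exprn_ge0// mulr_ge0// mulr_ge0// expR_ge0.
have main (s' : R) : 0 < s' -> s' <= 1 -> mean mu (fun t => f t ^+ 2) <= s' ^+ 2 ->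
    L%:R <= n%:R * s' ^+ 2 -> s' <= s ->
    a * mean mu (fun t => G t ^+ M.+1.*2) <=
    (8 * expR 1 * L%:R) ^+ L * s ^+ M.+1.*2.
  move=> s'0 s'1 fs' Ln' s's.
  have := mean_power_le bf f1 s'0 s'1 fs' k_gt0 LE Ln'.
  move=> /(ler_wpM2l a0) /le_trans; apply.
  apply: (@le_trans _ _ (n%:R ^+ L * ((8 * expR 1 * L%:R) ^+ L * s' ^+ M.+1.*2 / n%:R ^+ L))).
    rewrite ler_wpM2r// divr_ge0 ?exprn_ge0 ?(ltW nr0)//.
    by apply: mulr_ge0 => //; apply: exprn_ge0; exact: ltW.
  rewrite mulrCA divff ?mulr1 ?expf_neq0 ?gt_eqF//.
  by rewrite ler_wpM2l//; apply: lerXn2r => //; rewrite nnegrE ltW.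
have [s1|s1] := leP s 1; first by apply: (main s).
have [Ln1|nL] := leP (L%:R : R) n%:R.
  apply: (main 1) => //; rewrite ?expr1n ?mulr1// ?(ltW s1)//.
  rewrite -[leRHS](mean_cst mu k); apply: mean_le.
  - exact: bmeasX.
  - exact: bmeas_cst.
  - by move=> t; rewrite -[f t ^+ 2]real_normK ?num_real// expr_le1.
have G2 t : `|G t| <= 2 ^+ k.
  rewrite /G normrM normfV normrX normr_nat mulrC ler_pdivrMr ?exprn_gt0//.
  apply: le_trans (ler_norm_sum _ _ _) _.
  apply: (@le_trans _ _ (\sum_(c : {ffun 'I_k -> 'I_n}) 2 ^+ k)).
    by apply: ler_sum => c _; exact: diag_free_norm_le.
  by rewrite sumr_const card_ffun !card_ord -[leLHS]mulr_natr natrX.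
apply: (@le_trans _ _ (n%:R ^+ L * 4 ^+ L)).
  apply: ler_pM => //; first by apply: mean_ge0 => t; rewrite -mul2n exprM exprn_ge0// sqr_ge0.
  rewrite -[leRHS](mean_cst mu n); apply: mean_le; [exact: bmeasX|exact: bmeas_cst|].
  move=> t; rewrite -mul2n exprM -[G t ^+ 2]real_normK ?num_real// -exprM.
  have -> : 4 ^+ L = (2 ^+ k) ^+ (2 * M.+1) :> R.
    have -> : 4 = 2 ^+ 2 :> R by rewrite expr2 -natrM.
    by rewrite LE -!exprM; congr (_ ^+ _); ring.
  by apply: lerXn2r; rewrite ?nnegrE ?exprn_ge0.
rewrite -exprMn -[leLHS]mulr1; apply: ler_pM => //.
- apply: lerXn2r; rewrite ?nnegrE ?mulr_ge0 ?(ltW nr0) ?expR_ge0//.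
  rewrite mulrC; apply: ler_pM; rewrite ?(ltW nr0) ?(ltW nL)//.
  by move: e1; lra.
- by apply: exprn_ege1; exact: ltW.
Qed.

Lemma J_sum_tail dO (Omega : measurableType dO) (P : probability Omega R)
    (xi : 'I_n -> {RV P >-> X}) (s x : R) :
  mutually_independent xi -> (forall j, has_distribution (xi j) mu) ->
  0 < s -> mean mu (fun t => f t ^+ 2) <= s ^+ 2 ->
  0 < x -> x <= n%:R `^ (k%:R / 2) * s ^+ k.+1 ->
  (P [set w | (x < `|J_sum (sample xi w)|)%R] <=
   (expR k%:R * expR (- ((expR 1 * (8 * expR 1))^-1 * (x / s) `^ (2 / k%:R))))%:E)%E.
Proof.
move=> indep dist s0 fs x0 xle.
set y := (x / s) `^ (2 / k%:R); set E := expR 1; set K : R := 8 * E.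
set B := [set w | _].
have E1 : 1 <= E by rewrite -expR0 ler_expR.
have E0 : 0 < E by apply: lt_le_trans E1.
have K1 : 1 <= K by rewrite /K; lra.
have K0 : 0 < K by apply: lt_le_trans K1.
have xs0 : 0 < x / s by rewrite divr_gt0.
have y0 : 0 < y by rewrite powR_gt0.
have kr0 : 0 < k%:R :> R by rewrite ltr0n.
have yk : y ^+ k = (x / s) ^+ 2.
  rewrite -powR_mulrn ?(ltW y0)// -powRrM divfK ?gt_eqF//.
  by rewrite powR_mulrn// ltW.
have yn : y <= n%:R * s ^+ 2.
  rewrite -(ler_pXn2r (n := k))// ?nnegrE ?(ltW y0)//; last first.
    by rewrite mulr_ge0// sqr_ge0.
  rewrite yk [leRHS]exprMn -exprM.
  rewrite -powR_half_sqr [(2 * k)%N]mulnC exprM -exprMn; apply: lerXn2r.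
  - by rewrite nnegrE ltW.
  - by rewrite nnegrE mulr_ge0 ?powR_ge0// exprn_ge0// ltW.
  - by rewrite ler_pdivrMr// -mulrA -exprSr.
have mB : measurable B.
  have [mJ _] := bmeas_norm (bmeas_comp bmeas_J_sum (measurable_sample xi)).
  rewrite (_ : B = [set: Omega] `&` (fun w => `|J_sum (sample xi w)|) @^-1` `]x, +oo[).
    exact: mJ.
  by rewrite setTI; apply/seteqP; split => w /=; rewrite in_itv /= andbT.
rewrite -expRD; set z := y / (E * K * k%:R).
have zk : z * k%:R = (E * K)^-1 * y.
  by rewrite /z invfM mulrA divfK ?gt_eqF// mulrC.
have [M0|M0] := posnP (Num.truncn z).
  apply: (@le_trans _ _ 1%E); first exact: probability_le1.
  rewrite lee_fin -[leLHS]expR0 ler_expR -zk.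
  have := truncnS_gt z; rewrite M0 => z1.
  by rewrite subr_ge0 -[leRHS]mul1r ler_pM2r// ltW.
case: (Num.truncn z) M0 (truncnS_gt z) (@truncn_le _ z) => // M _ zM Mz.
have z0 : 0 <= z by rewrite divr_ge0 ?mulr_ge0 ?(ltW y0) ?(ltW E0) ?(ltW K0) ?(ltW kr0).
pose L := (M.+1 * k)%N.
have L0 : (0 < L)%N by rewrite muln_gt0 k_gt0.
have Ly : L%:R * K <= y * E^-1.
  have : L%:R <= (E * K)^-1 * y.
    by rewrite -zk /L natrM ler_pM2r// Mz.
  move=> /(ler_wpM2r (ltW K0)) /le_trans; apply.
  by rewrite invfM mulrAC divfK ?gt_eqF// mulrC.
have E'1 : E^-1 <= 1 by rewrite invf_le1.
have Ln : L%:R <= n%:R * s ^+ 2.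
  apply: le_trans yn; apply: (@le_trans _ _ (L%:R * K)); first by rewrite ler_peMr.
  by apply: le_trans Ly _; rewrite ler_piMr// ltW.
have mom := mean_J_sum_le s0 fs (erefl L) Ln.
rewrite -/E -/K in mom.
have bF : bmeas (fun w => J_sum (sample xi w) ^+ M.+1.*2).
  exact: bmeasX (bmeas_comp bmeas_J_sum (measurable_sample xi)).
have bB : bmeas (\1_B : Omega -> R).
  split; first exact: measurable_indic.
  by exists 1 => w; rewrite indicE; case: (w \in B); rewrite ?normr1 ?normr0.
have xm0 : 0 < x ^+ M.+1.*2 by exact: exprn_gt0.
have markov : x ^+ M.+1.*2 * fine (P B) <= (K * L%:R) ^+ L * s ^+ M.+1.*2.
  apply: le_trans mom; rewrite -(int_sample indep dist); last first.
    exact: bmeasX bmeas_J_sum.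
  have -> : fine (P B) = \int[P]_w \1_B w.
    by rewrite /Rintegral integral_indic// setIT.
  rewrite -intZ//; apply: int_le => //; first exact: bmeasZ.
  move=> w; rewrite indicE; case: (boolP (w \in B)) => [|_].
    rewrite inE /B /= mulr1 => xJ.
    rewrite -mul2n !exprM -[X in _ <= X ^+ _]real_normK ?num_real//.
    apply: lerXn2r; rewrite ?nnegrE ?sqr_ge0//.
    by apply: lerXn2r; rewrite ?nnegrE ?(ltW x0) ?(ltW xJ).
  by rewrite mulr0 -mul2n exprM exprn_ge0// sqr_ge0.
have fPB : P B \is a fin_num by exact: fin_num_measure.
rewrite -(fineK fPB) lee_fin.
have yL : y ^+ L = (x / s) ^+ M.+1.*2.
  by rewrite /L mulnC exprM yk -exprM mul2n.
have : fine (P B) <= (K * L%:R / y) ^+ L.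
  rewrite expr_div_n yL expr_div_n ler_pdivlMr; last first.
    by rewrite divr_gt0// exprn_gt0.
  rewrite mulrA ler_pdivrMr; last exact: exprn_gt0.
  by rewrite mulrC.
move=> /le_trans; apply; apply: (@le_trans _ _ (E^-1 ^+ L)).
  apply: lerXn2r; rewrite ?nnegrE ?invr_ge0 ?(ltW E0)//.
    by apply: divr_ge0; [apply: mulr_ge0 => //|]; exact: ltW.
  by rewrite ler_pdivrMr// mulrC [E^-1 * _]mulrC.
rewrite /E -expRN -expRM_natl ler_expR mulrN1 -zk.
have -> : - L%:R = k%:R - (M.+2%:R * k%:R) :> R.
  by rewrite /L natrM -[M.+2]add1n natrD mulrDl mul1r opprD addNKr.
by rewrite lerD2l lerN2 ler_pM2r// ltW.
Qed.

End Tail.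

Theorem mainTheorem2 (R : realType) (k : nat) (hk : (1 <= k)%N) :
  exists C alpha : R, [/\ 0 < C, 0 < alpha &
    forall (dX : measure_display) (X : measurableType dX)
      (mu : probability X R), non_atomic mu ->
    forall n : nat, (1 <= n)%N ->
    forall (dO : measure_display) (Omega : measurableType dO)
      (P : probability Omega R) (xi : 'I_n -> {RV P >-> X}),
      mutually_independent xi -> (forall j, has_distribution (xi j) mu) ->
    forall f : k.-tuple X -> R, measurable_fun [set: k.-tuple X] f ->
      (sup_norm f <= 1)%E ->
    forall sigma : R, 0 < sigma -> L2_norm_sq mu f <= sigma ^+ 2 ->
    forall x : R, 0 < x -> x <= n%:R `^ (k%:R / 2) * sigma ^+ k.+1 ->
      (outer_prob P [set w | (x < `|J mu (fun j => xi j w) f|)%R]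
        <= (C * expR (- (alpha * (x / sigma) `^ (2 / k%:R))))%:E)%E].
Proof.
exists (expR k%:R), (expR 1 * (8 * expR 1))^-1; split.
- exact: expR_gt0.
- by rewrite invr_gt0 !mulr_gt0// expR_gt0.
move=> dX X mu mu_na n hn dO Omega P xi indep dist f mf supf s s0 fs x x0 xle.
have f1 t : `|f t| <= 1.
  by rewrite -lee_fin; apply: le_trans supf; apply: ereal_sup_ubound; exists t.
have bf : bmeas f by split => //; exists 1.
have tail := J_sum_tail bf f1 hk hn indep dist s0 fs x0 xle.
apply/lee_addgt0Pr => e e0.
have [D [mD tiesD De]] := ties_null indep dist mu_na e0.
set B := (X in P X) in tail.
have mB : measurable B.
  have [mJ _] := bmeas_norm (bmeas_comp (bmeas_J_sum mu n bf) (measurable_sample xi)).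
  rewrite (_ : B = [set: Omega] `&` (fun w => `|J_sum mu f (sample xi w)|) @^-1` `]x, +oo[).
    exact: mJ.
  by rewrite setTI; apply/seteqP; split => w /=; rewrite in_itv /= andbT.
apply: (@le_trans _ _ (outer_prob P (B `|` D))).
  apply: le_mu_ext => w /= xJ.
  have [Dw|nDw] := pselect (D w); [by right|left].
  rewrite /B /=; move: xJ; rewrite (J_expansion mu_na hn)//.
  move=> i j xij; apply: contrapT => ij; apply: nDw; apply: tiesD.
  by exists i, j; split => //; exact/eqP.
rewrite /outer_prob measurable_mu_extE; last exact: measurableU.
apply: le_trans; first exact: measureU2.
exact: leeD.
Qed.
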